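(* Let $K$ be an algebraically closed field of characteristic $0$. (1) Let $m,n$ be positive integers, let $q=q_{\{1,\dots,m\}}\oplus\tilde q_{\{1,\dots,n\}}$ over $K$, and let $q_0:Km_0\times Km_0\to K$ be the $K$-quadratic form on a free supermodule $Km_0$ ($m_0$ even) given by $q_0(m_0,m_0)=1$. Then $\operatorname{eosp}(q)=\operatorname{osp}(2m,2n)$ and $\operatorname{eosp}(q\oplus q_0)=\operatorname{osp}(2m+1,2n)$. (2) Let $A$ be a superextension of $K$ and let $L=\operatorname{osp}(m,2n)$ with $m,n$ positive integers. Then $\operatorname{Der}_K(L\otimes A)\cong\operatorname{ad}(L\otimes A)\rtimes\operatorname{Der}_KA$. In particular, for $A=K$, $L$ has no outer derivations, i.e. $\operatorname{Der}_KL=\operatorname{ad}L$.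
   Context: All structures are $\mathbb Z_2$-graded; $|z|$ is the degree of a homogeneous element, and formulas involving $|z|$ extend linearly. $K$ is regarded as a superring with $K_{\bar1}=0$. A $K$-quadratic form on a $K$-supermodule (super vector space) $M$ is a bilinear form $q:M\times M\to K$ of degree $\bar0$ with $q(m,n)=(-1)^{|m||n|}q(n,m)$; $\oplus$ denotes orthogonal sum. $q_{\{1,\dots,m\}}$ is the form on the space with basis of even elements $h_{\pm1},\dots,h_{\pm m}$ given by $q(h_{\sigma i},h_{-\mu j})=\delta_{\sigma\mu}\delta_{ij}$ ($\sigma,\mu\in\{\pm\}$). $\tilde q_{\{1,\dots,n\}}$ is the analogous (nondegenerate, alternating) form on the purely odd space with basis $\tilde h_{\pm1},\dots,\tilde h_{\pm n}$: $\tilde q(\tilde h_i,\tilde h_{-j})=\delta_{ij}=-\tilde q(\tilde h_{-j},\tilde h_i)$, all other products of basis elements $0$. $\mathbf E_{m,n}(p)=m\,q(n,p)-(-1)^{|n||p|}q(m,p)n$, and $\operatorname{eosp}(q)$ is the span of all $\mathbf E_{m,n}$. $\operatorname{osp}(r,2n)$ is the Lie superalgebra of all endomorphisms $x$ of a super vector space of even dimension $r$ and odd dimension $2n$ with $q(x(m),n)+(-1)^{|m||n|}q(x(n),m)=0$, where $q$ is a nondegenerate $K$-quadratic form on it; the bracket is $[x,y]=xy-(-1)^{|x||y|}yx$. A superextension $A$ of $K$ is a unital associative supercommutative $K$-superalgebra. $L\otimes A$ has bracket $[x\otimes a,y\otimes b]=(-1)^{|a||y|}[x,y]\otimes ab$.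 $\operatorname{Der}_K$ is spanned by the homogeneous $K$-linear $d$ with $d(xy)=d(x)y+(-1)^{|d||x|}x\,d(y)$; $\operatorname{ad}(x)(y)=[x,y]$; $X\rtimes Y$ denotes a semidirect product with ideal $X$ and subalgebra $Y$. *)

(* Defs.v *)
From HB Require Import structures.
From mathcomp Require Import all_boot all_order all_algebra.

Set Implicit Arguments.
Unset Strict Implicit.
Unset Printing Implicit Defensive.

Import GRing.Theory.
Local Open Scope ring_scope.

(* Degrees in Z/2Z are booleans ([true] is odd), with addition [(+)] and      *)
(* product [&&].  A Z/2Z-grading of V is given by its two projections:        *)
(* [g b v] is the degree-b component of v.                                    *)

Section Gradings.
Variable K : fieldType.

Definition is_grading (V : lmodType K) (g : bool -> V -> V) : Prop :=
  [/\ forall b, linear (g b),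
      forall v, g false v + g true v = v
    & forall b c v, g b (g c v) = if b == c then g c v else 0].

Definition homog (V : lmodType K) (g : bool -> V -> V) (b : bool) (v : V) :=
  g b v = v.

Definition pure_grading (V : lmodType K) (b0 : bool) (b : bool) (v : V) : V :=
  if b == b0 then v else 0.

Definition prod_grading (V W : lmodType K) (gV : bool -> V -> V)
    (gW : bool -> W -> W) (b : bool) (v : V * W) : V * W :=
  (gV b v.1, gW b v.2).

Definition sdim (V : vectType K) (g : bool -> V -> V) (b : bool) : nat :=
  \dim (limg (linfun (g b))).

Lemma pure_gradingP (V : lmodType K) b0 : is_grading (@pure_grading V b0).
Proof.
split=> [b a u v|v|b c v]; rewrite /pure_grading.
- by case: eqP; rewrite ?scaler0 ?addr0.
- by case: b0; rewrite /= ?add0r ?addr0.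
- by case: b; case: c; case: b0.
Qed.

Lemma prod_gradingP (V W : lmodType K) gV gW :
  @is_grading V gV -> @is_grading W gW -> is_grading (prod_grading gV gW).
Proof.
case=> lV sV pV [lW sW pW]; split=> [b a [u1 u2] [v1 v2]|[v w]|b c [v w]].
- by rewrite /prod_grading /= lV lW.
- by rewrite /prod_grading /= -[RHS]/(v, w) -[in RHS](sV v) -[in RHS](sW w).
- by rewrite /prod_grading /= pV pW; case: eqP.
Qed.

End Gradings.

(* K-linear endomorphisms are handled as plain functions up to [=1], so that  *)
(* the same notions serve the infinite-dimensional L (x) A.                   *)

Section Endomorphisms.
Variables (K : fieldType) (W : lmodType K) (g : bool -> W -> W).
Implicit Types (f h : W -> W) (X Y : (W -> W) -> Prop).

Definition of_degree (b : bool) f : Prop :=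
  forall c w, homog g c w -> homog g (b (+) c) (f w).

Definition epart (b : bool) f (w : W) : W :=
  \sum_(c : bool) g (b (+) c) (f (g c w)).

(* [f,h] = f h - (-1)^(|f||h|) h f, extended bilinearly. *)
Definition sbracket f h (w : W) : W :=
  \sum_(a : bool) \sum_(b : bool)
     (epart a f (epart b h w) - (-1) ^+ (a && b) *: epart b h (epart a f w)).

Definition in_span (S : (W -> W) -> Prop) f : Prop :=
  exists (k : nat) (c : 'I_k -> K) (F : 'I_k -> W -> W),
    (forall i, S (F i)) /\ f =1 (fun w => \sum_i c i *: F i w).

Section Superalgebra.
Variable br : W -> W -> W.

Definition homog_derivation (b : bool) (d : W -> W) : Prop :=
  [/\ linear d, of_degree b d
    & forall c x y, homog g c x ->
        d (br x y) = br (d x) y + (-1) ^+ (b && c) *: br x (d y)].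

Definition Der (d : W -> W) : Prop :=
  in_span (fun f => exists b, homog_derivation b f) d.

Definition ad (d : W -> W) : Prop := exists x, d =1 br x.

End Superalgebra.

Definition graded_subspace X : Prop :=
  [/\ X (fun=> 0),
      forall (a : K) f h, X f -> X h -> X (fun w => a *: f w + h w)
    & forall b f, X f -> X (epart b f)].

(* G = X >| Y, X an ideal and Y a subalgebra of the Lie superalgebra G. *)
Definition semidirect G X Y : Prop :=
  [/\ [/\ graded_subspace X, forall f, X f -> G f
        & forall f h, G f -> X h -> X (sbracket f h)],
      [/\ graded_subspace Y, forall f, Y f -> G f
        & forall f h, Y f -> Y h -> Y (sbracket f h)],
      forall f, G f -> exists x y, [/\ X x, Y y & f =1 (fun w => x w + y w)]
    & forall f, X f -> Y f -> f =1 (fun=> 0)].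

End Endomorphisms.

(* phi is an isomorphism of Lie superalgebras from X onto its image. *)
Definition lie_embedding (K : fieldType) (V W : lmodType K)
    (gV : bool -> V -> V) (gW : bool -> W -> W)
    (X : (V -> V) -> Prop) (phi : (V -> V) -> W -> W) : Prop :=
  [/\ forall (a : K) d e, X d -> X e ->
        phi (fun v => a *: d v + e v) =1 (fun w => a *: phi d w + phi e w),
      forall b d, X d -> phi (epart gV b d) =1 epart gW b (phi d),
      forall d e, X d -> X e ->
        phi (sbracket gV d e) =1 sbracket gW (phi d) (phi e)
    & forall d, X d -> phi d =1 (fun=> 0) -> d =1 (fun=> 0)].

Lemma epart_linear (K : fieldType) (W : lmodType K) (g : bool -> W -> W) b f :
  is_grading g -> linear f -> linear (epart g b f).
Proof.
case=> lg _ _ lf a u v; rewrite /epart scaler_sumr -big_split /=.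
by apply: eq_bigr => c _; rewrite lg lf lg.
Qed.

Lemma epart_homog (K : fieldType) (W : lmodType K) (g : bool -> W -> W) b c f w :
  is_grading g -> linear f -> homog g c w -> epart g b f w = g (b (+) c) (f w).
Proof.
move=> [lg sg pg] lf hw; rewrite /epart (bigD1 c) //= big1 => [|c' nc].
  by rewrite hw addr0.
have f0 : f 0 = 0 by have := lf (-1) 0 0; rewrite !scaleN1r oppr0 addr0 addNr.
have g0 b' : g b' 0 = 0.
  by have := lg b' (-1) 0 0; rewrite !scaleN1r oppr0 addr0 addNr.
by rewrite -hw pg (negPf nc) f0 g0.
Qed.

Lemma sbracket_linear (K : fieldType) (W : lmodType K) (g : bool -> W -> W) f h :
  is_grading g -> linear f -> linear h -> linear (sbracket g f h).
Proof.
move=> hg lf lh a u v; rewrite /sbracket scaler_sumr -big_split /=.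
apply: eq_bigr => c _; rewrite scaler_sumr -big_split /=; apply: eq_bigr => d _.
rewrite !(epart_linear _ hg lf, epart_linear _ hg lh).
by rewrite scalerDr scalerBr !scalerA [a * _]mulrC addrACA opprD.
Qed.

Definition image_of (S T : Type) (X : (S -> S) -> Prop)
    (phi : (S -> S) -> T -> T) (f : T -> T) : Prop :=
  exists2 d, X d & f =1 phi d.

Definition superextension (K : fieldType) (A : algType K)
    (g : bool -> A -> A) : Prop :=
  [/\ is_grading g, homog g false 1,
      forall a b x y, homog g a x -> homog g b y -> homog g (a (+) b) (x * y)
    & forall a b x y, homog g a x -> homog g b y ->
        x * y = (-1) ^+ (a && b) *: (y * x)].

Section QuadraticForms.
Variable K : fieldType.

Section OnSupermodule.
Variables (V : vectType K) (g : bool -> V -> V) (q : V -> V -> K).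

Definition quadratic_form : Prop :=
  [/\ forall u, scalar (q u), forall v, scalar (q^~ v),
      forall a b u v, homog g a u -> homog g b v -> a != b -> q u v = 0
    & forall a b u v, homog g a u -> homog g b v ->
        q u v = (-1) ^+ (a && b) * q v u].

Definition nondegenerate : Prop :=
  forall u, (forall v, q u v = 0) -> u = 0.

(* q is a form of the kind from which osp(r, s) is built. *)
Definition osp_datum (r s : nat) : Prop :=
  [/\ is_grading g, sdim g false = r, sdim g true = s, quadratic_form
    & nondegenerate].

(* E_{u,v}(p) = u q(v,p) - (-1)^(|v||p|) q(u,p) v, extended linearly. *)
Definition Emap (u v p : V) : V :=
  q v p *: u - \sum_(b : bool) \sum_(c : bool)
                  ((-1) ^+ (b && c) * q u (g c p)) *: g b v.

Definition eosp (x : 'End(V)) : Prop :=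
  in_span (fun f => exists u v, f =1 Emap u v) x.

Definition osp (x : 'End(V)) : Prop :=
  forall a b u v, homog g a u -> homog g b v ->
    q (x u) v + (-1) ^+ (a && b) * q (x v) u = 0.

End OnSupermodule.

Definition orth_sum (V W : lmodType K) (qV : V -> V -> K) (qW : W -> W -> K)
    (u v : V * W) : K := qV u.1 v.1 + qW u.2 v.2.

Definition form_of_gram (I : finType) (B : I -> I -> K)
    (u v : {ffun I -> K^o}) : K :=
  \sum_(i : I) \sum_(j : I) u i * v j * B i j.

(* The index (i, true) stands for the basis vector h_{+i} and (i, false) for  *)
(* h_{-i}; indices i range over 0, ..., m-1.                                  *)
Definition hyp_space (m : nat) : vectType K := {ffun 'I_m * bool -> K^o}.

Definition hyp_form (m : nat) : hyp_space m -> hyp_space m -> K :=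
  form_of_gram (fun i j : 'I_m * bool =>
    ((i.1 == j.1) && (i.2 != j.2))%:R).

Definition alt_form (n : nat) : hyp_space n -> hyp_space n -> K :=
  form_of_gram (fun i j : 'I_n * bool =>
    if i.1 == j.1 then i.2%:R - j.2%:R else 0).

Definition unit_form (u v : K^o) : K := u * v.

End QuadraticForms.

Section TensorProduct.
Variables (K : fieldType) (U : vectType K).

(* For U of finite dimension with basis (e_i), U (x) A is realised as the     *)
(* space of families (a_i) in A, standing for \sum_i e_i (x) a_i; see         *)
(* [tens_universal] below.                                                    *)
Definition tensor (A : lmodType K) : lmodType K :=
  {ffun 'I_(\dim {:U}) -> A}.

Definition tbasis (i : 'I_(\dim {:U})) : U := (vbasis {:U})`_i.

Definition tens (A : lmodType K) (x : U) (a : A) : tensor A :=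
  [ffun i => coord (vbasis {:U}) i x *: a].

Definition bilin (A M : lmodType K) (f : U -> A -> M) : Prop :=
  (forall x, linear (f x)) /\ (forall a, linear (f^~ a)).

Lemma tens_bilin (A : lmodType K) : bilin (@tens A).
Proof.
split=> [x k a b|a k x y]; apply/ffunP=> i; rewrite !ffunE.
  by rewrite scalerDr !scalerA mulrC.
by rewrite linearP scalerDl scalerA.
Qed.

Lemma tens_decomp (A : lmodType K) (t : tensor A) :
  t = \sum_i tens (tbasis i) (t i).
Proof.
apply/ffunP=> j; rewrite sum_ffunE (bigD1 j) //= big1 => [|i ij]; rewrite ffunE.
  by rewrite coord_free ?(basis_free (vbasisP _)) // eqxx scale1r addr0.
by rewrite coord_free ?(basis_free (vbasisP _)) // (negPf ij) scale0r.
Qed.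

Lemma tens_eval (A M : lmodType K) (f : U -> A -> M) x a :
  bilin f -> \sum_i f (tbasis i) (tens x a i) = f x a.
Proof.
case=> f1 f2.
pose g := HB.pack_for {linear U -> M} (f^~ a)
  (GRing.isLinear.Build _ _ _ _ (f^~ a) (f2 a)).
rewrite [in RHS](coord_vbasis (memvf x)) -[RHS]/(g _) linear_sum.
apply: eq_bigr => i _; rewrite ffunE linearZ /=.
pose h := HB.pack_for {linear A -> M} (f (tbasis i))
  (GRing.isLinear.Build _ _ _ _ (f (tbasis i)) (f1 (tbasis i))).
by rewrite -[LHS]/(h _) linearZ.
Qed.

Lemma tens_universal (A M : lmodType K) (f : U -> A -> M) : bilin f ->
  exists F : tensor A -> M,
    [/\ linear F, forall x a, F (tens x a) = f x a
      & forall F', linear F' -> (forall x a, F' (tens x a) = f x a) -> F' =1 F].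
Proof.
move=> fb; exists (fun t : tensor A => \sum_i f (tbasis i) (t i)).
split=> [k t s|x a|F' lF' F'f t].
- rewrite scaler_sumr -big_split; apply: eq_bigr => i _.
  by rewrite !ffunE (proj1 fb).
- exact: tens_eval.
- pose G := HB.pack_for {linear tensor A -> M} F' (GRing.isLinear.Build _ _ _ _ F' lF').
  rewrite [in LHS](tens_decomp t) -[F' _]/(G _) linear_sum.
  by apply: eq_bigr => i _; apply: F'f.
Qed.

Variables (gU : bool -> U -> U) (brU : U -> U -> U).

Definition tens_grading (A : lmodType K) (gA : bool -> A -> A) (b : bool)
    (t : tensor A) : tensor A :=
  \sum_i \sum_(c : bool) tens (gU c (tbasis i)) (gA (b (+) c) (t i)).

(* [x (x) a, y (x) b] = (-1)^(|a||y|) [x,y] (x) ab *)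
Definition tens_bracket (A : algType K) (gA : bool -> A -> A)
    (t s : tensor A) : tensor A :=
  \sum_i \sum_j \sum_(c : bool) \sum_(d : bool)
    (-1) ^+ (c && d) *:
      tens (brU (tbasis i) (gU d (tbasis j))) (gA c (t i) * s j).

(* (id (x) d)(x (x) a) = (-1)^(|d||x|) x (x) d(a) *)
Definition id_tens (A : lmodType K) (gA : bool -> A -> A) (d : A -> A)
    (t : tensor A) : tensor A :=
  \sum_i \sum_(b : bool) \sum_(c : bool)
    (-1) ^+ (b && c) *: tens (gU c (tbasis i)) (epart gA b d (t i)).

Hypothesis hgU : is_grading gU.

Lemma tens_grading_pure (A : lmodType K) (gA : bool -> A -> A) b c d x a :
  is_grading gA -> homog gU c x -> homog gA d a ->
  tens_grading gA b (tens x a) = if b == c (+) d then tens x a else 0.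
Proof.
move=> hgA hx ha; have [lU _ pU] := hgU; have [lA _ pA] := hgA.
have [t1 t2] := tens_bilin A.
pose f x a := \sum_(c : bool) tens (gU c x) (gA (b (+) c) a).
have fb : bilin f.
  split=> [y k u v|y k u v]; rewrite /f scaler_sumr -big_split;
  apply: eq_bigr => e _; first by rewrite lA t1.
  by rewrite lU t2.
transitivity (f x a); first exact: tens_eval fb.
have t01 y : tens y (0 : A) = 0.
  by have := t1 y (-1) 0 0; rewrite scaler0 addr0 scaleN1r addNr.
have t02 (y : A) : tens 0 y = 0.
  by have := t2 y (-1) 0 0; rewrite scaler0 addr0 scaleN1r addNr.
rewrite /f (bigD1 c) //= big1 => [|c' cc']; last first.
  by rewrite -hx pU (negPf cc') t02.
rewrite addr0 hx -ha pA; have -> : (b (+) c == d) = (b == c (+) d).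
  by clear; case: b c d => [] [] [].
by case: eqP => _; rewrite ?t01.
Qed.

Lemma tens_bracket_pure (A : algType K) (gA : bool -> A -> A) c d x a y b :
  is_grading gA -> bilin brU -> homog gA c a -> homog gU d y ->
  tens_bracket gA (tens x a) (tens y b)
    = (-1) ^+ (c && d) *: tens (brU x y) (a * b).
Proof.
move=> hgA [br1 br2] ha hy; have [lU _ pU] := hgU; have [lA _ pA] := hgA.
have [t1 t2] := tens_bilin A.
have t01 z : tens z (0 : A) = 0.
  by have := t1 z (-1) 0 0; rewrite scaler0 addr0 scaleN1r addNr.
have t02 (z : A) : tens 0 z = 0.
  by have := t2 z (-1) 0 0; rewrite scaler0 addr0 scaleN1r addNr.
have br0 z : brU z 0 = 0.
  by have := br1 z (-1) 0 0; rewrite scaler0 addr0 scaleN1r addNr.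
pose f x y a b : tensor A := \sum_(c : bool) \sum_(d : bool)
  (-1) ^+ (c && d) *: tens (brU x (gU d y)) (gA c a * b).
have fl (x' : U) (a' : A) : bilin (fun y b => f x' y a' b).
  split=> [z k u v|z k u v]; rewrite /f scaler_sumr -big_split; apply: eq_bigr => e _;
  rewrite scaler_sumr -big_split; apply: eq_bigr => e' _;
  rewrite /= scalerA [k * _]mulrC -scalerA -scalerDr.
    by rewrite mulrDr -scalerAr t1.
  by rewrite lU br1 t2.
have fr (y' : U) (b' : A) : bilin (fun x a => f x y' a b').
  split=> [z k u v|z k u v]; rewrite /f scaler_sumr -big_split; apply: eq_bigr => e _;
  rewrite scaler_sumr -big_split; apply: eq_bigr => e' _;
  rewrite /= scalerA [k * _]mulrC -scalerA -scalerDr.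
    by rewrite lA mulrDl -scalerAl t1.
  by rewrite br2 t2.
transitivity (f x y a b).
  rewrite -(tens_eval x a (fr y b)); apply: eq_bigr => i _.
  by rewrite -(tens_eval y b (fl _ _)).
rewrite /f (bigD1 c) //= [X in _ + X]big1 => [|c' cc']; last first.
  by apply: big1 => d' _; rewrite -ha pA (negPf cc') mul0r t01 scaler0.
rewrite addr0 (bigD1 d) //= big1 ?addr0 ?ha ?hy // => d' dd'.
by rewrite -hy pU (negPf dd') br0 t02 scaler0.
Qed.

Lemma id_tens_pure (A : lmodType K) (gA : bool -> A -> A) b c d x a :
  is_grading gA -> linear d -> of_degree gA b d -> homog gU c x ->
  id_tens gA d (tens x a) = (-1) ^+ (b && c) *: tens x (d a).
Proof.
move=> hgA ld hd hx; have [lU _ pU] := hgU; have [lA sA pA] := hgA.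
have [t1 t2] := tens_bilin A.
have t01 z : tens z (0 : A) = 0.
  by have := t1 z (-1) 0 0; rewrite scaler0 addr0 scaleN1r addNr.
have t02 (z : A) : tens 0 z = 0.
  by have := t2 z (-1) 0 0; rewrite scaler0 addr0 scaleN1r addNr.
have dE b' : epart gA b' d a = if b' == b then d a else 0.
  have hh e : homog gA e (gA e a) by rewrite /homog pA eqxx.
  have E e : gA (b' (+) e) (d (gA e a)) = if b' == b then d (gA e a) else 0.
    rewrite -(hd _ _ (hh e)) pA.
    by have -> : (b' (+) e == b (+) e) = (b' == b) by clear; case: b b' e => [] [] [].
  rewrite /epart; under eq_bigr => e _ do rewrite E.
  case: eqP => _; last by rewrite big1.
  have dD u v : d (u + v) = d u + d v by have := ld 1 u v; rewrite !scale1r.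
  by rewrite big_bool /= -dD addrC sA.
pose f x a := \sum_(b : bool) \sum_(c : bool)
    (-1) ^+ (b && c) *: tens (gU c x) (epart gA b d a).
have fb : bilin f.
  split=> [y k u v|y k u v]; rewrite /f scaler_sumr -big_split;
    apply: eq_bigr => e _; rewrite scaler_sumr -big_split;
    apply: eq_bigr => e' _;
  rewrite /= scalerA [k * _]mulrC -scalerA -scalerDr.
    by rewrite (epart_linear e hgA ld) t1.
  by rewrite lU t2.
transitivity (f x a); first exact: tens_eval fb.
rewrite /f (bigD1 b) //= [X in _ + X]big1 => [|b' bb']; last first.
  by apply: big1 => e _; rewrite dE (negPf bb') t01 scaler0.
rewrite addr0 (bigD1 c) //= big1 => [|c' cc']; last first.
  by rewrite -hx pU (negPf cc') t02 scaler0.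
by rewrite addr0 hx dE eqxx.
Qed.

End TensorProduct.

Section OspSubalgebra.
Variables (K : fieldType) (V : vectType K) (g : bool -> V -> V).
Variable q : V -> V -> K.
Hypotheses (hg : is_grading g) (hq : quadratic_form g q).

Lemma osp_vspace : exists L : {vspace 'End(V)}, forall x, x \in L <-> osp g q x.
Proof.
have [lg sg pg] := hg; have [lq1 lq2 _ _] := hq.
pose n := \dim {:V}; pose e (i : 'I_n) := (vbasis {:V})`_i.
pose M (x : 'End(V)) : {ffun bool * bool -> 'M[K]_(n, n)} :=
  [ffun p => \matrix_(i, j) (q (x (g p.1 (e i))) (g p.2 (e j))
     + (-1) ^+ (p.1 && p.2) * q (x (g p.2 (e j))) (g p.1 (e i)))].
have linM : linear M.
  move=> a x y; apply/ffunP=> p; rewrite !ffunE; apply/matrixP=> i j.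
  rewrite !mxE !add_lfunE !scale_lfunE !lq2 mulrDr mulrDr addrACA; congr (_ + _).
  by rewrite mulrCA.
pose lM := HB.pack_for {linear 'End(V) -> {ffun bool * bool -> 'M[K]_(n, n)}} M
   (GRing.isLinear.Build _ _ _ _ M linM).
exists (lker (linfun lM)) => x; rewrite memv_ker lfunE /=; split.
- move/eqP/ffunP=> Mx a b u v hu hv.
  rewrite -hu -hv (coord_vbasis (memvf u)) (coord_vbasis (memvf v)).
  pose gl c := HB.pack_for {linear V -> V} (g c)
    (GRing.isLinear.Build _ _ _ _ (g c) (lg c)).
  pose ql w := HB.pack_for {scalar V} (q w)
    (GRing.isLinear.Build _ _ _ _ (q w) (lq1 w)).
  pose qr w := HB.pack_for {scalar V} (q^~ w)
    (GRing.isLinear.Build _ _ _ _ (q^~ w) (lq2 w)).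
  have q1 w (s : seq V) (cs : 'I_n -> K) (f : 'I_n -> V) :
     q w (\sum_i cs i *: f i) = \sum_i cs i * q w (f i).
    rewrite -[q w]/(ql w : V -> K) linear_sum.
    by apply: eq_bigr => i _; rewrite linearZ.
  have q2 w (s : seq V) (cs : 'I_n -> K) (f : 'I_n -> V) :
     q (\sum_i cs i *: f i) w = \sum_i cs i * q (f i) w.
    rewrite -[q _ w]/(qr w _) linear_sum.
    by apply: eq_bigr => i _; rewrite linearZ.
  have gs c (cs : 'I_n -> K) : g c (\sum_i cs i *: e i) = \sum_i cs i *: g c (e i).
    rewrite -[g c]/(gl c : V -> V) linear_sum.
    by apply: eq_bigr => i _; rewrite linearZ.
  have xs c (cs : 'I_n -> K) :
      x (\sum_i cs i *: g c (e i)) = \sum_i cs i *: x (g c (e i)).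
    by rewrite linear_sum; apply: eq_bigr => i _; rewrite linearZ.
  rewrite !gs !xs !(q2 _ [::]).
  under eq_bigr => i _ do rewrite (q1 _ [::]).
  under [X in _ * X]eq_bigr => i _ do rewrite (q1 _ [::]).
  rewrite mulr_sumr.
  under [X in _ + X]eq_bigr => i _ do rewrite !mulr_sumr.
  under eq_bigr => i _ do rewrite mulr_sumr.
  rewrite [X in _ + X]exchange_big -big_split big1 //= => i _.
  rewrite -big_split big1 //= => j _.
  move: (Mx (a, b)); rewrite !ffunE => /matrixP /(_ i j); rewrite !mxE /= => E.
  apply/eqP; rewrite -(mulr0 (coord (vbasis {:V}) i u * coord (vbasis {:V}) j v)).
  by rewrite -E mulrDr !mulrA; apply/eqP; congr (_ + _); rewrite -!mulrA;
     rewrite !(mulrCA ((-1) ^+ _)) [in LHS]mulrCA.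
- move=> ox; apply/eqP/ffunP=> -[a b]; rewrite !ffunE; apply/matrixP=> i j.
  by rewrite !mxE /=; apply: ox; rewrite /homog pg eqxx.
Qed.

Lemma form_part c b w v :
  homog g b v -> q (g c w) v = if c == b then q w v else 0.
Proof.
have [lg sg pg] := hg; have [_ lq2 dq _] := hq => hv.
have hc d z : homog g d (g d z) by rewrite /homog pg eqxx.
case: eqP => [->|/eqP cb]; last exact: dq (hc _ _) hv cb.
have qD y z : q (y + z) v = q y v + q z v.
  by have := lq2 v 1 y z; rewrite /= scale1r mul1r.
rewrite -{2}(sg w) qD; case: (b) hv => hv.
- by rewrite [X in X + _](dq _ _ _ _ (hc _ _) hv) // add0r.
- by rewrite [X in _ + X](dq _ _ _ _ (hc _ _) hv) // addr0.
Qed.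

Lemma osp_part b x : osp g q x -> osp g q (linfun (epart g b x)).
Proof.
move=> ox a a' u v hu hv.
pose el := HB.pack_for {linear V -> V} (epart g b x)
  (GRing.isLinear.Build _ _ _ _ (epart g b x) (epart_linear b hg (linearP x))).
rewrite -[epart g b x]/(el : V -> V) !lfunE /=.
rewrite (epart_homog b hg (linearP x) hu) (epart_homog b hg (linearP x) hv).
rewrite (form_part _ _ hv) (form_part _ _ hu).
have <- : (b (+) a == a') = (b (+) a' == a) by clear; case: b a a' => [] [] [].
by case: eqP => _; [apply: ox | rewrite mulr0 addr0].
Qed.

Lemma osp_bracket x y :
  osp g q x -> osp g q y -> osp g q (linfun (sbracket g x y)).
Proof.
move=> ox oy.
have [lg sg pg] := hg; have [lq1 lq2 dq sq] := hq.
have lx := @linearP _ _ _ _ x; have ly := @linearP _ _ _ _ y.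
pose bl := HB.pack_for {linear V -> V} (sbracket g x y)
  (GRing.isLinear.Build _ _ _ _ _ (sbracket_linear hg lx ly)).
have qs w (F : bool -> V) : q (\sum_(i : bool) F i) w = \sum_(i : bool) q (F i) w.
  pose qr := HB.pack_for {scalar V} (q^~ w)
    (GRing.isLinear.Build _ _ _ _ (q^~ w) (lq2 w)).
  by rewrite -[LHS]/(qr _) linear_sum.
have qB w k y1 y2 : q (y1 - k *: y2) w = q y1 w - k * q y2 w.
  by rewrite -scaleNr addrC (lq2 w) mulNr addrC.
have hc d z : homog g d (g d z) by rewrite /homog pg eqxx.
pose X c := linfun (epart g c x); pose Y c := linfun (epart g c y).
have XE c w : X c w = epart g c x w.
  pose el := HB.pack_for {linear V -> V} (epart g c x)
    (GRing.isLinear.Build _ _ _ _ _ (epart_linear c hg lx)).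
  by rewrite /X -[epart g c x]/(el : V -> V) lfunE.
have YE c w : Y c w = epart g c y w.
  pose el := HB.pack_for {linear V -> V} (epart g c y)
    (GRing.isLinear.Build _ _ _ _ _ (epart_linear c hg ly)).
  by rewrite /Y -[epart g c y]/(el : V -> V) lfunE.
have key (f h : 'End(V)) c d a a' u v : osp g q f -> osp g q h ->
    of_degree g c f -> of_degree g d h -> homog g a u -> homog g a' v ->
    q (f (h u)) v = (-1) ^+ (c && d) * ((-1) ^+ (a && a') * q (h (f v)) u).
  move=> of_ oh df dh hu hv.
  have /eqP := of_ _ _ _ _ (dh _ _ hu) hv; rewrite addr_eq0 => /eqP ->.
  rewrite (sq _ _ _ _ (df _ _ hv) (dh _ _ hu)).
  have /eqP := oh _ _ _ _ hu (df _ _ hv); rewrite addr_eq0 => /eqP ->.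
  rewrite !mulrN opprK !mulrA -!signr_addb; congr (_ * _); congr (_ ^+ nat_of_bool _).
  by clear; case: c d a a' => [] [] [] [].
have dX c : of_degree g c (X c).
  by move=> a w hw; rewrite XE (epart_homog c hg lx hw); apply: hc.
have dY c : of_degree g c (Y c).
  by move=> a w hw; rewrite YE (epart_homog c hg ly hw); apply: hc.
move=> a a' u v hu hv; rewrite -[sbracket g x y]/(bl : V -> V) !lfunE /=.
rewrite /sbracket !qs mulr_sumr.
rewrite -big_split big1 //= => c _; rewrite !qs mulr_sumr.
rewrite -big_split big1 //= => d _.
rewrite !qB -!YE -!XE.
rewrite (key _ _ c d _ _ _ _ (osp_part c ox) (osp_part d oy) (dX c) (dY d) hu hv).
rewrite (key _ _ c d _ _ _ _ (osp_part c ox) (osp_part d oy) (dX c) (dY d) hv hu).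
rewrite [a' && a]andbC mulrBr !(mulrCA ((-1) ^+ (a && a')) ((-1) ^+ (c && d))).
by rewrite signrMK -/(X c) -/(Y d) addrA subrK subrr.
Qed.

End OspSubalgebra.

(* A graded subalgebra L of End(V) as a Lie superalgebra.  [vsproj L] only    *)
(* repackages elements of L; see [vsval_sub_grading], [vsval_sub_bracket].    *)
Section SubLie.
Variables (K : fieldType) (V : vectType K) (g : bool -> V -> V).
Variable L : {vspace 'End(V)}.

Definition sub_grading (b : bool) (x : subvs_of L) : subvs_of L :=
  vsproj L (linfun (epart g b (vsval x))).

Definition sub_bracket (x y : subvs_of L) : subvs_of L :=
  vsproj L (linfun (sbracket g (vsval x) (vsval y))).


Lemma vsval_sub_grading b (x : subvs_of L) :
  is_grading g -> linfun (epart g b (vsval x)) \in L ->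
  vsval (sub_grading b x) =1 epart g b (vsval x).
Proof.
move=> hg hL v; rewrite /sub_grading vsprojK //.
pose el := HB.pack_for {linear V -> V} (epart g b (vsval x))
  (GRing.isLinear.Build _ _ _ _ _ (epart_linear b hg (linearP (vsval x)))).
by rewrite -[epart g b _]/(el : V -> V) lfunE.
Qed.

Lemma vsval_sub_bracket (x y : subvs_of L) :
  is_grading g -> linfun (sbracket g (vsval x) (vsval y)) \in L ->
  vsval (sub_bracket x y) =1 sbracket g (vsval x) (vsval y).
Proof.
move=> hg hL v; rewrite /sub_bracket vsprojK //.
pose el := HB.pack_for {linear V -> V} (sbracket g (vsval x) (vsval y))
  (GRing.isLinear.Build _ _ _ _ _
     (sbracket_linear hg (linearP (vsval x)) (linearP (vsval y)))).
by rewrite -[sbracket g _ _]/(el : V -> V) lfunE.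
Qed.

End SubLie.

(* Main.v *)
Require Import Defs.
From HB Require Import structures.
From mathcomp Require Import all_boot all_order all_algebra.
From mathcomp Require Import ring.
Import GRing.Theory.
Local Open Scope ring_scope.

Set Implicit Arguments.
Unset Strict Implicit.
Unset Printing Implicit Defensive.

(** Write [E(u,v)] for the map called [Emap g q u v].

    If [x_i, y_i] are dual homogeneous families of a nondegenerate form, every skew map [f]
    satisfies [2 f = sum_i E(f x_i, y_i)]: one half of the terms of the right-hand side expands [f]
    along [x_i], and skewness turns the other half into an expansion along [y_i] ([osp_Emaps]).
    So [eosp = osp] for every nondegenerate form ([eosp_eq_osp]), and the first part only asks that
    the explicit forms be nondegenerate of the right dimensions.

    For the second part, let [T = L (x) A] and let [D] be a homogeneous derivation of [T].  The odd
    part of [V] is nonzero, so it contains [e, f] with [q f e = 1]; put [V' = <e,f>^perp].  Then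
    [E(e,e)], [h = E(e,f)], [E(f,f)] span a copy of [sl2] in [L], and [ad h] grades [T]:
    its weights are [2, 1, 0, -1, -2], on [E(e,e)A], [E(e,V')A], [E(e,f)A + E(V',V')A], [E(f,V')A]
    and [E(f,f)A].  This single element [h] replaces root systems and treats all [m, n] alike.
    The derivation [D] is brought to zero in three moves.

    - Subtracting an inner derivation puts [D h] in weight 0.  The Leibniz rule then forces
      [D h = 0] and makes [D] act on [E(e,e)] and [E(f,f)] as the bracket with some [E(e,f)a], so
      a second inner derivation makes [D] vanish on [sl2] ([der_minus_ad_sl2]).
    - Now [D] commutes with [sl2], hence sends [E(e,e)a] to [E(e,e)d(a)] for a map [d] of [A], which
      is a derivation because [E(e,f)a] acts on [E(e,e)A] as multiplication by [2a] ([der_sl2A]).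
      Subtract [id (x) d].
    - What remains sends [E(e,v)] to [E(e,F(v))] for some [F : V' -> V' (x) A].  As [D] vanishes on
      [E(e,e)A], which contains all [[E(e,v), E(e,w)]], the map [F] is skew, and the expansion of
      skew maps used for the first part exhibits it as the bracket with an element of [E(V',V')A]
      ([der_frame_inner]).  After this last subtraction [D] vanishes on generators of [T]
      ([derivation_eq0]).

    The argument only uses how [T] is generated by the elements [E(u,v)a], so it is carried out for
    any [osp_current].  Both [L (x) A] and [L] itself, with [A = K], are such; in the second case
    [d = 0] and all derivations are inner.

    Finally [id (x) d] is faithful in [d], and it is inner only when it is zero: it vanishes on
    [L (x) 1], while [[t, x (x) a]] is [[t, x (x) 1]] multiplied by [a] on the right
    ([tens_semidirect]). *)

(** * Identities in modules *)

Section ModuleExpressions.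
Variables (K : comPzRingType) (M : lmodType K).

(** Syntax for the reflexive tactic [module] below, which proves a linear identity between vectors
    by comparing coefficients with [ring].  It settles the case analyses on parities, where each
    side is a signed combination of the same few vectors. *)
Inductive mexpr :=
  MVar of nat | MZero | MAdd of mexpr & mexpr | MOpp of mexpr
  | MScale of K & mexpr.

Fixpoint meval (env : seq M) e : M :=
  match e with
  | MVar i => env`_i
  | MZero => 0
  | MAdd e1 e2 => meval env e1 + meval env e2
  | MOpp e1 => - meval env e1
  | MScale k e1 => k *: meval env e1
  end.

Fixpoint mcoef (i : nat) e : K :=
  match e with
  | MVar j => if eqn j i then 1 else 0
  | MZero => 0
  | MAdd e1 e2 => mcoef i e1 + mcoef i e2
  | MOpp e1 => - mcoef i e1
  | MScale k e1 => k * mcoef i e1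
  end.

Fixpoint msame (n : nat) e1 e2 : Prop :=
  if n is n'.+1 then mcoef n' e1 = mcoef n' e2 /\ msame n' e1 e2 else True.

Lemma mevalE env e : meval env e = \sum_(i < size env) mcoef i e *: env`_i.
Proof.
elim: e => [j||e1 IH1 e2 IH2|e1 IH|k e1 IH] /=.
- case: (ltnP j (size env)) => hj.
    rewrite (bigD1 (Ordinal hj)) //= -[eqn j j]/(j == j) eqxx scale1r big1 ?addr0 // => i.
    rewrite -val_eqE /= -[eqn j i]/(j == i :> nat) eq_sym => /negPf ->.
    by rewrite scale0r.
  rewrite nth_default // big1 // => i _; rewrite -[eqn j i]/(j == i :> nat).
  by case: eqP (ltn_ord i) => [<-|_]; rewrite ?scale0r // ltnNge hj.
- by rewrite big1 // => i _; rewrite scale0r.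
- by rewrite IH1 IH2 -big_split; apply: eq_bigr => i _; rewrite /= scalerDl.
- by rewrite IH -sumrN; apply: eq_bigr => i _; rewrite scaleNr.
- by rewrite IH scaler_sumr; apply: eq_bigr => i _; rewrite scalerA.
Qed.

Lemma meval_eq env e1 e2 : msame (size env) e1 e2 -> meval env e1 = meval env e2.
Proof.
move=> h; rewrite !mevalE; apply: eq_bigr => i _; congr (_ *: _).
elim: (size env) i h => [|n IH] [i hi] //= [h1 h2].
case: (ltngtP i n) hi => [lt _|lt le|-> _]; [exact: (IH (Ordinal lt)) | | exact: h1].
by move: (leq_trans le lt); rewrite ltnn.
Qed.

End ModuleExpressions.

(* Atoms are compared up to conversion: the same vector may be reached with structure arguments
   that are convertible without being identical. *)
Ltac msame_atom x t := match goal with _ => unify x t end.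
Ltac matom env t :=
  match env with
  | nil => constr:(0%N)
  | cons t _ => constr:(0%N)
  | cons ?x _ => let _ := msame_atom x t in constr:(0%N)
  | cons _ ?env' => let n := matom env' t in constr:(S n)
  end.
Ltac mpush env t :=
  match env with
  | nil => constr:(cons t nil)
  | cons t _ => env
  | cons ?x _ => let _ := msame_atom x t in env
  | cons ?x ?env' => let r := mpush env' t in constr:(cons x r)
  end.
Ltac matoms env t :=
  lazymatch t with
  | @GRing.zero _ => env
  | @GRing.add _ ?x ?y => let e := matoms env x in matoms e y
  | @GRing.opp _ ?x => matoms env x
  | @GRing.scale _ _ _ ?x => matoms env x
  | _ => mpush env t
  end.
Ltac mreify K env t :=
  lazymatch t with
  | @GRing.zero _ => constr:(@MZero K)
  | @GRing.add _ ?x ?y =>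
     let a := mreify K env x in let b := mreify K env y in constr:(MAdd a b)
  | @GRing.opp _ ?x => let a := mreify K env x in constr:(MOpp a)
  | @GRing.scale _ _ ?k ?x => let a := mreify K env x in constr:(@MScale K k a)
  | _ => let n := matom env t in constr:(@MVar K n)
  end.
Ltac module K :=
  lazymatch goal with
  | |- @eq ?T ?l ?r =>
     let env := matoms (@nil T) l in
     let env := matoms env r in
     let e1 := mreify K env l in
     let e2 := mreify K env r in
     refine (@meval_eq K _ env e1 e2 _); cbn [msame size mcoef eqn];
     repeat split; ring
  end.

(** * Gradings and parity components *)

(* Maps are bare functions with a linearity proof, so the usual rewriting rules are restated for
   them. *)
Section LinearFunctions.
Variables (K : fieldType) (U W : lmodType K) (f : U -> W).
Hypothesis lf : linear f.

Let F := HB.pack_for {linear U -> W} f (GRing.isLinear.Build _ _ _ _ f lf).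

Lemma lin0 : f 0 = 0. Proof. exact: (linear0 F). Qed.
Lemma linD u v : f (u + v) = f u + f v. Proof. exact: (linearD F). Qed.
Lemma linN u : f (- u) = - f u. Proof. exact: (linearN F). Qed.
Lemma linB u v : f (u - v) = f u - f v. Proof. exact: (linearB F). Qed.
Lemma linZ a u : f (a *: u) = a *: f u. Proof. by rewrite -[a *: u]addr0 lf lin0 addr0. Qed.
Lemma lin_sum (I : Type) (r : seq I) (P : pred I) (E : I -> U) :
  f (\sum_(i <- r | P i) E i) = \sum_(i <- r | P i) f (E i).
Proof. exact: (linear_sum F). Qed.

End LinearFunctions.

Section Gradings.
Variables (K : fieldType) (W : lmodType K) (g : bool -> W -> W).
Hypothesis hg : is_grading g.

Lemma gr_lin b : linear (g b). Proof. by case: hg. Qed.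

Lemma gr_homog b v : homog g b (g b v).
Proof. by case: hg => _ _ p; rewrite /homog p eqxx. Qed.

Lemma gr_pure b c v : homog g c v -> g b v = if b == c then v else 0.
Proof. by case: hg => _ _ p hv; rewrite -{1}hv p hv. Qed.

Lemma gr_sum v : v = \sum_(b : bool) g b v.
Proof. by case: hg => _ s _; rewrite big_bool /= addrC s. Qed.

Lemma homog0 b : homog g b 0. Proof. exact: lin0 (gr_lin b). Qed.

Lemma homogD b u v : homog g b u -> homog g b v -> homog g b (u + v).
Proof. by rewrite /homog (linD (gr_lin b)) => -> ->. Qed.

Lemma homogZ b a v : homog g b v -> homog g b (a *: v).
Proof. by rewrite /homog (linZ (gr_lin b)) => ->. Qed.

Lemma homogN b v : homog g b v -> homog g b (- v).
Proof. by rewrite /homog (linN (gr_lin b)) => ->. Qed.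

Lemma homogB b u v : homog g b u -> homog g b v -> homog g b (u - v).
Proof. by move=> hu hv; apply/homogD/homogN. Qed.

Lemma homog_sum b (I : Type) (r : seq I) (P : pred I) (E : I -> W) :
  (forall i, P i -> homog g b (E i)) -> homog g b (\sum_(i <- r | P i) E i).
Proof. by move=> h; rewrite /homog (lin_sum (gr_lin b)); apply: eq_bigr. Qed.

Lemma epart_ext b f f' : f =1 f' -> epart g b f =1 epart g b f'.
Proof. by move=> e w; apply: eq_bigr => c _; rewrite e. Qed.

Lemma epart_lincomb b a f f' :
  epart g b (fun w => a *: f w + f' w)
    =1 (fun w => a *: epart g b f w + epart g b f' w).
Proof.
move=> w; rewrite /epart scaler_sumr -big_split /=.
by apply: eq_bigr => c _; rewrite gr_lin.
Qed.

Lemma epart_degree b f : linear f -> of_degree g b (epart g b f).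
Proof. by move=> lf c w hw; rewrite (epart_homog b hg lf hw); apply: gr_homog. Qed.

Lemma epart_sum f w : linear f -> f w = \sum_(b : bool) epart g b f w.
Proof.
move=> lf; rewrite exchange_big /= {1}[w]gr_sum (lin_sum lf).
apply: eq_bigr => c _; rewrite {1}[f _]gr_sum !big_bool /=.
by case: c => //=; rewrite addrC.
Qed.

(** The way in which statements are reduced to homogeneous vectors everywhere below. *)
Lemma eq_of_homog (M : lmodType K) (f f' : W -> M) : linear f -> linear f' ->
  (forall c w, homog g c w -> f w = f' w) -> f =1 f'.
Proof.
move=> lf lf' e w; rewrite [w]gr_sum (lin_sum lf) (lin_sum lf').
by apply: eq_bigr => c _; apply: e; apply: gr_homog.
Qed.

Lemma epart_pure b c f : linear f -> of_degree g c f ->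
  epart g b f =1 (fun w => if b == c then f w else 0).
Proof.
move=> lf df; apply: eq_of_homog; first exact: epart_linear.
  by move=> a u v /=; case: eqP => _; rewrite ?lf // scaler0 addr0.
move=> a w hw; rewrite (epart_homog b hg lf hw) (gr_pure _ (df _ _ hw)).
by congr (if _ then _ else _); case: (a) b c {df hw} => [] [] [].
Qed.

Lemma sbracket_ext f f' h h' : f =1 f' -> h =1 h' ->
  sbracket g f h =1 sbracket g f' h'.
Proof.
move=> ef eh w; apply: eq_bigr => a _; apply: eq_bigr => b _.
by rewrite (epart_ext b eh w) !(epart_ext a ef) (epart_ext b eh).
Qed.

End Gradings.

(** * Derivations of graded algebras *)

Section Derivations.
Variables (K : fieldType) (W : lmodType K) (g : bool -> W -> W).
Variable br : W -> W -> W.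

(** What the theory of derivations needs of a product: it serves both the bracket of a Lie
    superalgebra and the multiplication of [A]. *)
Record graded_product : Prop := GradedProduct {
  prod_graded : is_grading g;
  prod_linr : forall x, linear (br x);
  prod_linl : forall y, linear (br^~ y) }.

Hypothesis hP : graded_product.
Let hg := prod_graded hP.
Let brr := prod_linr hP.
Let brl := prod_linl hP.

Lemma brDl x y z : br (x + y) z = br x z + br y z. Proof. exact: (linD (brl z)). Qed.
Lemma brZl a x z : br (a *: x) z = a *: br x z. Proof. exact: (linZ (brl z)). Qed.
Lemma brBl x y z : br (x - y) z = br x z - br y z. Proof. exact: (linB (brl z)). Qed.
Lemma br0l z : br 0 z = 0. Proof. exact: (lin0 (brl z)). Qed.
Lemma br_suml z (I : Type) (r : seq I) (P : pred I) (E : I -> W) :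
  br (\sum_(i <- r | P i) E i) z = \sum_(i <- r | P i) br (E i) z.
Proof. exact: (lin_sum (brl z)). Qed.

Lemma homog_derivation_ext b d d' :
  d =1 d' -> homog_derivation g br b d -> homog_derivation g br b d'.
Proof.
move=> e [ld dd Ld]; split=> [a u v|c w hw|c x y hx]; rewrite -!e; first exact: ld.
  exact: dd.

exact: Ld hx.
Qed.

Lemma homog_derivation_lincomb b a d e :
  homog_derivation g br b d -> homog_derivation g br b e ->
  homog_derivation g br b (fun w => a *: d w + e w).
Proof.
move=> [ld dd Ld] [le de Le]; split=> [k u v|c w hw|c x y hx].
- by rewrite ld le; module K.
- exact: (homogD hg (homogZ hg a (dd _ _ hw)) (de _ _ hw)).
- by rewrite (Ld _ _ _ hx) (Le _ _ _ hx) brDl brZl (linD (brr x)) (linZ (brr x)); module K.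
Qed.

Lemma homog_derivation0 b : homog_derivation g br b (fun=> 0).
Proof.
split=> [a u v|c w hw|c x y hx]; first by rewrite scaler0 addr0.
  exact: homog0.
by rewrite br0l (lin0 (brr x)) scaler0 addr0.
Qed.

Lemma homog_derivationB b d e :
  homog_derivation g br b d -> homog_derivation g br b e ->
  homog_derivation g br b (fun w => d w - e w).
Proof.
move=> hd he; apply: homog_derivation_ext (homog_derivation_lincomb (-1) he hd).
by move=> w; rewrite scaleN1r addrC.
Qed.

Lemma homog_derivation_sum b (k : nat) (c : 'I_k -> K) (F : 'I_k -> W -> W)
    (P : pred 'I_k) :
  (forall i, P i -> homog_derivation g br b (F i)) ->
  homog_derivation g br b (fun w => \sum_(i | P i) c i *: F i w).
Proof.
move=> hF; rewrite /index_enum; elim: (Finite.enum _) => [|i r IH].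
  by apply: homog_derivation_ext (homog_derivation0 b) => w; rewrite big_nil.
case Pi: (P i); last first.
  by apply: homog_derivation_ext IH => w; rewrite big_cons Pi.
apply: homog_derivation_ext (homog_derivation_lincomb (c i) (hF i Pi) IH) => w.
by rewrite big_cons Pi.
Qed.

(** A linear combination of homogeneous derivations can be sorted by degree; this makes [Der]
    manageable. *)
Lemma DerE d : Der g br d <->
  exists d0 d1, [/\ homog_derivation g br false d0,
                    homog_derivation g br true d1
                  & d =1 (fun w => d0 w + d1 w)].
Proof.
split=> [[k [c [F [hF e]]]]|[d0 [d1 [h0 h1 e]]]]; last first.
  exists 2, (fun=> 1), (fun i => if i == ord0 then d0 else d1); split=> [i|w].
    by case: eqP => _; [exists false|exists true].
  by rewrite e !big_ord_recl big_ord0 /= !scale1r addr0.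
have [p hp] := fin_all_exists hF.
exists (fun w => \sum_(i | ~~ p i) c i *: F i w).
exists (fun w => \sum_(i | p i) c i *: F i w); split.
- by apply: homog_derivation_sum => i pi; have := hp i; rewrite (negPf pi).
- by apply: homog_derivation_sum => i pi; have := hp i; rewrite pi.
- by move=> w; rewrite e (bigID p) /= addrC.
Qed.

Lemma Der_ext d d' : d =1 d' -> Der g br d -> Der g br d'.
Proof.
move=> e /DerE[d0 [d1 [h0 h1 de]]]; apply/DerE; exists d0, d1; split=> // w.
by rewrite -e.
Qed.

Lemma Der_homog b d : homog_derivation g br b d -> Der g br d.
Proof.
move=> hd; apply/DerE; have h0 := homog_derivation0; case: b hd => hd.
  by exists (fun=> 0), d; split=> // w; rewrite add0r.
by exists d, (fun=> 0); split=> // w; rewrite addr0.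
Qed.

Lemma Der_linear d : Der g br d -> linear d.
Proof.
case/DerE=> d0 [d1 [[l0 _ _] [l1 _ _] e]] a u v.
by rewrite !e l0 l1; module K.
Qed.

Lemma Der_lincomb a d e : Der g br d -> Der g br e ->
  Der g br (fun w => a *: d w + e w).
Proof.
case/DerE=> d0 [d1 [h0 h1 ed]] /DerE[e0 [e1 [k0 k1 ee]]]; apply/DerE.
exists (fun w => a *: d0 w + e0 w), (fun w => a *: d1 w + e1 w).
split; [exact: homog_derivation_lincomb..|move=> w].
by rewrite ed ee; module K.
Qed.

Lemma Der_sum (d : bool -> W -> W) :
  (forall b, Der g br (d b)) -> Der g br (fun w => \sum_(b : bool) d b w).
Proof.
move=> hd; apply: Der_ext (Der_lincomb 1 (hd true) (hd false)) => w.
by rewrite big_bool scale1r.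
Qed.

Lemma Der_epart b d : Der g br d -> homog_derivation g br b (epart g b d).
Proof.
case/DerE=> d0 [d1 [h0 h1 e]]; have [l0 dg0 _] := h0; have [l1 dg1 _] := h1.
have E : (fun w => (if b == false then d0 w else 0) + (if b == true then d1 w else 0))
    =1 epart g b d.
  move=> w; rewrite (@epart_ext _ _ _ _ _ (fun w => 1 *: d0 w + d1 w)); last first.
    by move=> v; rewrite e scale1r.
  rewrite (epart_lincomb hg) scale1r.
  by rewrite (epart_pure hg b l0 dg0) (epart_pure hg b l1 dg1).
apply: homog_derivation_ext E _; case: b; rewrite /=.
  by apply: homog_derivation_ext h1 => w; rewrite add0r.
by apply: homog_derivation_ext h0 => w; rewrite addr0.
Qed.

Lemma homog_derivation_bracket a b d e :
  homog_derivation g br a d -> homog_derivation g br b e ->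
  homog_derivation g br (a (+) b)
    (fun w => d (e w) - (-1) ^+ (a && b) *: e (d w)).
Proof.
move=> [ld dd Ld] [le de Le]; split=> [k u v|c w hw|c x y hx].
- by rewrite le ld ld le; module K.
- apply: (homogB hg); first by rewrite -addbA; apply/dd/de.
  by apply: (homogZ hg); rewrite (addbC a) -addbA; apply/de/dd.
- rewrite (Le _ _ _ hx) (Ld _ _ _ hx) !(linD ld, linD le, linZ ld, linZ le).
  rewrite (Ld _ _ _ (de _ _ hx)) (Ld _ _ _ hx).
  rewrite (Le _ _ _ (dd _ _ hx)) (Le _ _ _ hx).
  rewrite brBl brZl (linB (brr x)) (linZ (brr x)).
  by case: a b c {ld dd Ld le de Le hx} => [] [] [] /=; module K.
Qed.

Lemma Der_bracket d e : Der g br d -> Der g br e -> Der g br (sbracket g d e).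
Proof.
move=> hd he; apply: Der_sum => a; apply: Der_sum => b.
exact: Der_homog (homog_derivation_bracket (Der_epart a hd) (Der_epart b he)).
Qed.

End Derivations.

(** * Lie superalgebras and their inner derivations *)

Section LieSuperalgebras.
Variables (K : fieldType) (W : lmodType K) (g : bool -> W -> W).
Variable br : W -> W -> W.

(** The Jacobi identity is put in the form saying that [br x] is a derivation; since it is linear
    in [z], only [x] and [y] have to be homogeneous. *)
Record lie_super : Prop := LieSuper {
  lie_product : graded_product g br;
  lie_deg : forall a b x y,
    homog g a x -> homog g b y -> homog g (a (+) b) (br x y);
  lie_skew : forall a b x y, homog g a x -> homog g b y ->
    br x y = - ((-1) ^+ (a && b) *: br y x);
  lie_jacobi : forall a b x y z, homog g a x -> homog g b y ->
    br x (br y z) = br (br x y) z + (-1) ^+ (a && b) *: br y (br x z) }.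

Hypothesis hL : lie_super.
Let hP := lie_product hL.
Let hg := prod_graded hP.
Let brr := prod_linr hP.
Let brl := prod_linl hP.

Lemma ad_homog_derivation b x :
  homog g b x -> homog_derivation g br b (br x).
Proof.
move=> hx; split=> [|c y hy|c y z hy]; first exact: brr.
  exact: (lie_deg hL).
exact: (lie_jacobi hL).
Qed.

Lemma Der_ad x : Der g br (br x).
Proof.
apply: (@Der_ext _ _ _ _ hP (fun y => \sum_(b : bool) br (g b x) y)).
  by move=> y; rewrite {2}[x](gr_sum hg) (br_suml hP).
apply: (Der_sum hP) => b; apply: (Der_homog hP (b := b)); apply: ad_homog_derivation.
exact: (gr_homog hg).
Qed.

Lemma epart_ad b x : epart g b (br x) =1 br (g b x).
Proof.
move=> w; rewrite (@epart_ext _ _ _ _ _ (fun y => 1 *: br (g false x) y + br (g true x) y)).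
  rewrite (epart_lincomb hg) scale1r.
  have [l0 d0 _] := ad_homog_derivation (gr_homog hg false x).
  have [l1 d1 _] := ad_homog_derivation (gr_homog hg true x).
  rewrite (epart_pure hg b l0 d0) (epart_pure hg b l1 d1).
  by case: (b) => /=; rewrite ?add0r ?addr0.
by move=> y; rewrite {1}[x](gr_sum hg) big_bool (brDl hP) addrC scale1r.
Qed.

(** An inner derivation is moved by a derivation as its element is: the ideal
    property of [ad] is the Leibniz rule read as a commutation relation. *)
Lemma sbracket_ad d x : Der g br d -> sbracket g d (br x) =1 br (d x).
Proof.
move=> hd w; have ld := Der_linear hP hd.
rewrite {2}[x](gr_sum hg) (lin_sum ld) (br_suml hP).
under [RHS]eq_bigr => b _ do rewrite (epart_sum hg _ ld) (br_suml hP).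
rewrite exchange_big; apply: eq_bigr => a _; apply: eq_bigr => b _.
have [lda _ Ld] := Der_epart hP a hd.
by rewrite !epart_ad (Ld _ _ _ (gr_homog hg b x)) addrK.
Qed.

End LieSuperalgebras.

(** * The tensor product of a Lie superalgebra with a superextension *)

Section LinearClosure.
Variables (K : fieldType) (U V W : lmodType K).

Lemma lin_comp (f : V -> W) (h : U -> V) :
  linear f -> linear h -> linear (fun x => f (h x)).
Proof. by move=> lf lh a u v; rewrite lh lf. Qed.

Lemma lin_scale k (f : U -> W) : linear f -> linear (fun x => k *: f x).
Proof. by move=> lf a u v; rewrite lf; module K. Qed.

Lemma lin_add (f h : U -> W) :
  linear f -> linear h -> linear (fun x => f x + h x).
Proof. by move=> lf lh a u v; rewrite lf lh; module K. Qed.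

Lemma lin_bigsum (I : Type) (r : seq I) (f : I -> U -> W) :
  (forall i, linear (f i)) -> linear (fun x => \sum_(i <- r) f i x).
Proof.
move=> lf a u v; rewrite scaler_sumr -big_split.
by apply: eq_bigr => i _; apply: lf.
Qed.

End LinearClosure.

Section Superextension.
Variables (K : fieldType) (A : algType K) (gA : bool -> A -> A).
Hypothesis hA : superextension gA.

Lemma mulr_graded_product : graded_product gA *%R.
Proof.
case: hA => hg _ _ _; split=> // [x a u v|y a u v] /=.
  by rewrite mulrDr scalerAr.
by rewrite mulrDl scalerAl.
Qed.

Lemma homog_derivation1 b d : homog_derivation gA *%R b d -> d 1 = 0.
Proof.
case: hA => _ h1 _ _ [ld _ Ld]; have := Ld _ 1 1 h1.
by rewrite andbF scale1r !mulr1 mul1r => /esym/(canRL (addrK _)); rewrite subrr.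
Qed.

End Superextension.

Section TensorLie.
Variables (K : fieldType) (U : vectType K) (gU : bool -> U -> U) (brU : U -> U -> U).
Variables (A : algType K) (gA : bool -> A -> A).
Hypothesis hU : lie_super gU brU.
Hypothesis hA : superextension gA.

Let T := tensor U A.
Let gT := @tens_grading K U gU A gA.
Let brT := @tens_bracket K U gU brU A gA.
Let hgU := prod_graded (lie_product hU).
Let hgA : is_grading gA. Proof. by case: hA. Qed.
Let hPA := mulr_graded_product hA.

Lemma tens_linr x : linear (@tens K U A x).
Proof. by case: (@tens_bilin K U A). Qed.

Lemma tens_linl a : linear ((@tens K U A)^~ a).
Proof. by case: (@tens_bilin K U A). Qed.

Lemma tensor_lin (M : lmodType K) (f : 'I_(\dim {:U}) -> A -> M) :
  (forall i, linear (f i)) -> linear (fun t : T => \sum_i f i (t i)).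
Proof. by move=> lf; apply: lin_bigsum => i a u v; rewrite !ffunE lf. Qed.

Lemma tens_ext (M : lmodType K) (F F' : T -> M) : linear F -> linear F' ->
  (forall c d x a, homog gU c x -> homog gA d a ->
     F (tens x a) = F' (tens x a)) -> F =1 F'.
Proof.
move=> lF lF' e t; rewrite (tens_decomp t) (lin_sum lF) (lin_sum lF').
apply: eq_bigr => i _; move: (tbasis i) (t i) => x a.
have l1 b := tens_linl b; have l2 y := tens_linr y.
apply: (@eq_of_homog _ _ _ hgU _ (fun x => F (tens x a)) (fun x => F' (tens x a)));
  try by apply: lin_comp => //.
move=> c y hy; apply: (@eq_of_homog _ _ _ hgA _ (fun a => F (tens y a))
  (fun a => F' (tens y a))); try by apply: lin_comp => //.
by move=> d b hb; apply: e hy hb.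
Qed.

Lemma tens_homog c d x a : homog gU c x -> homog gA d a ->
  homog gT (c (+) d) (tens x a).
Proof.
by move=> hx ha; rewrite /homog /gT (tens_grading_pure hgU _ hgA hx ha) eqxx.
Qed.

(** Homogeneous version of [tens_ext]: a homogeneous tensor is a sum of pure tensors of the same
    total degree. *)
Lemma tens_homog_ext c (M : lmodType K) (F F' : T -> M) : linear F -> linear F' ->
  (forall d e x a, c = d (+) e -> homog gU d x -> homog gA e a ->
     F (tens x a) = F' (tens x a)) -> forall t, homog gT c t -> F t = F' t.
Proof.
move=> lF lF' e t <-; rewrite /gT /tens_grading.
rewrite (lin_sum lF) (lin_sum lF'); apply: eq_bigr => i _.
rewrite (lin_sum lF) (lin_sum lF'); apply: eq_bigr => d _.
apply: (e d (c (+) d)); try exact: gr_homog.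
by rewrite addbCA addbb addbF.
Qed.

Lemma tens_grading_lin b : linear (gT b).
Proof.
rewrite /gT /tens_grading; apply: (tensor_lin (f := fun i a =>
  \sum_(c : bool) tens (gU c (tbasis i)) (gA (b (+) c) a))) => i.
apply: lin_bigsum => c; apply: lin_comp; first exact: tens_linr.
exact: (gr_lin hgA).
Qed.

Lemma tens_is_grading : is_grading gT.
Proof.
split; first exact: tens_grading_lin.
- apply: (@tens_ext _ (fun t => gT false t + gT true t)) => //.
    by apply: lin_add; apply: tens_grading_lin.
  move=> c d x a hx ha; rewrite /gT !(tens_grading_pure hgU _ hgA hx ha).
  by case: (c (+) d); rewrite /= ?addr0 ?add0r.
- move=> b c; apply: (@tens_ext _ (fun t => gT b (gT c t))
    (fun t => if b == c then gT c t else 0)).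
  + by apply: lin_comp; apply: tens_grading_lin.
  + by case: eqP => _ a u v; rewrite ?tens_grading_lin // scaler0 addr0.
  + move=> d e x a hx ha; rewrite /gT !(tens_grading_pure hgU _ hgA hx ha).
    have g0 : tens_grading gU gA b 0 = 0 := lin0 (tens_grading_lin b).
    case: (c =P d (+) e) => [->|_]; last by rewrite g0; case: eqP.
    by rewrite (tens_grading_pure hgU _ hgA hx ha).
Qed.

Lemma tens_bracket_linl s : linear (brT^~ s).
Proof.
rewrite /brT /tens_bracket; apply: (tensor_lin (f := fun i a =>
  \sum_j \sum_(c : bool) \sum_(d : bool) (-1) ^+ (c && d) *:
      tens (brU (tbasis i) (gU d (tbasis j))) (gA c a * s j))) => i.
do 3!apply: lin_bigsum => ?; apply: lin_scale.
apply: (lin_comp (f := tens _)); first exact: tens_linr.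
apply: (lin_comp (f := *%R^~ _)); first exact: (prod_linl hPA).
exact: (gr_lin hgA).
Qed.

Lemma tens_bracket_linr t : linear (brT t).
Proof.
rewrite /brT /tens_bracket; apply: lin_bigsum => i.
apply: (tensor_lin (f := fun j a =>
  \sum_(c : bool) \sum_(d : bool) (-1) ^+ (c && d) *:
      tens (brU (tbasis i) (gU d (tbasis j))) (gA c (t i) * a))) => j.
do 2!apply: lin_bigsum => ?; apply: lin_scale.
apply: (lin_comp (f := tens _)); first exact: tens_linr.
exact: (prod_linr hPA).
Qed.

Lemma tens_graded_product : graded_product gT brT.
Proof.
split; [exact: tens_is_grading | exact: tens_bracket_linr | exact: tens_bracket_linl].
Qed.

Lemma tens_bracketE c d x a y b : homog gA c a -> homog gU d y ->
  brT (tens x a) (tens y b) = (-1) ^+ (c && d) *: tens (brU x y) (a * b).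
Proof.
apply: (tens_bracket_pure hgU x b hgA).
by split=> ?; [apply: (prod_linr (lie_product hU))|apply: (prod_linl (lie_product hU))].
Qed.

Lemma tens_lie_super : lie_super gT brT.
Proof.
have [_ h1 hM hC] := hA; have ll := tens_bracket_linl; have lr := tens_bracket_linr.
have lt := tens_linr; have dU := lie_deg hU; have gl := tens_grading_lin.
split; first exact: tens_graded_product.
- move=> a b s t hs ht; move: s hs.
  apply: (tens_homog_ext (F := fun s => gT (a (+) b) (brT s t)) (F' := brT^~ t)) => //.
    exact: (lin_comp (f := gT _)).
  move=> c d x e -> hx he; move: t ht.
  apply: (tens_homog_ext (F := fun t => gT _ (brT _ t)) (F' := brT _)) => //.
    exact: (lin_comp (f := gT _)).
  move=> c' d' x' e' -> hx' he'; rewrite (tens_bracketE _ _ he hx').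
  rewrite (linZ (gl _)); congr (_ *: _); rewrite -addbA [d (+) _]addbCA addbA.
  exact: tens_homog (dU _ _ _ _ hx hx') (hM _ _ _ _ he he').
- move=> a b s t hs ht; move: s hs.
  apply: (tens_homog_ext (F := brT^~ t) (F' := fun s => - ((-1) ^+ (a && b) *: brT t s))) => //.
    by move=> k u v; rewrite lr; module K.
  move=> c d x e -> hx he; move: t ht.
  apply: (tens_homog_ext (F := brT _)
    (F' := fun t => - ((-1) ^+ ((c (+) d) && b) *: brT t (tens x e)))) => //.
    by move=> k u v; rewrite ll; module K.
  move=> c' d' x' e' -> hx' he'.
  rewrite (tens_bracketE _ _ he hx') (tens_bracketE _ _ he' hx).
  rewrite (lie_skew hU hx hx') (hC _ _ _ _ he he').
  rewrite (linZ (lt _)) (linN (tens_linl _)) (linZ (tens_linl _)).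
  by case: c d c' d' {hx he hx' he'} => [] [] [] [] /=; module K.
- move=> a b s t z hs ht; move: s hs.
  apply: (tens_homog_ext (F := brT^~ _)
    (F' := fun s => brT (brT s t) z + (-1) ^+ (a && b) *: brT t (brT s z))) => //.
    by move=> k u v; rewrite !ll lr; module K.
  move=> c d x e -> hx he; move: t ht.
  apply: (tens_homog_ext (F := fun t => brT _ (brT t z))
    (F' := fun t => brT (brT _ t) z + (-1) ^+ ((c (+) d) && b) *: brT t (brT (tens x e) z))) => //.
  + by move=> k u v; rewrite !ll lr.
  + by move=> k u v; rewrite lr !ll; module K.
  move=> c' d' x' e' -> hx' he'.
  move: z; apply: (tens_ext (F := fun z => brT _ (brT _ z))
    (F' := fun z => brT _ z + (-1) ^+ ((c (+) d) && (c' (+) d')) *: brT _ (brT _ z))).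
  + by apply: lin_comp.
  + by move=> k u v; rewrite !lr; module K.
  move=> c'' d'' x'' e'' hx'' he''.
  rewrite (tens_bracketE _ _ he hx') (tens_bracketE _ _ he hx'') (tens_bracketE _ _ he' hx'').
  rewrite (linZ (ll _)) !(linZ (lr _)).
  rewrite (tens_bracketE _ _ he (dU _ _ _ _ hx' hx'')).
  rewrite (tens_bracketE _ _ he' (dU _ _ _ _ hx hx'')).
  rewrite (tens_bracketE _ _ (hM _ _ _ _ he he') hx'').
  rewrite (lie_jacobi hU _ hx hx') (linD (tens_linl _)) (linZ (tens_linl _)).
  rewrite mulrA (mulrA e') (hC _ _ _ _ he he') -scalerAl !(linZ (lt _)).
  by case: c d c' d' c'' d'' {hx he hx' he' hx'' he''} => [] [] [] [] [] [] /=; module K.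
Qed.


Let hT := tens_lie_super.
Let hPT := tens_graded_product.
Let hgT := tens_is_grading.
Let phi := @id_tens K U gU A gA.

Lemma id_tens_ext d d' : d =1 d' -> phi d =1 phi d'.
Proof.
move=> e t; apply: eq_bigr => i _; apply: eq_bigr => b _; apply: eq_bigr => c _.
by rewrite (epart_ext gA b e).
Qed.

Lemma id_tens_lincomb k d e :
  phi (fun a => k *: d a + e a) =1 (fun t => k *: phi d t + phi e t).
Proof.
move=> t; rewrite /phi /id_tens scaler_sumr -big_split; apply: eq_bigr => i _.
rewrite /= scaler_sumr -big_split; apply: eq_bigr => b _.
rewrite /= scaler_sumr -big_split; apply: eq_bigr => c _.
by rewrite /= (epart_lincomb hgA) tens_linr; module K.
Qed.

Lemma id_tens_lin d : linear d -> linear (phi d).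
Proof.
move=> ld; rewrite /phi /id_tens; apply: (tensor_lin (f := fun i a =>
  \sum_(b : bool) \sum_(c : bool) (-1) ^+ (b && c) *: tens (gU c (tbasis i)) (epart gA b d a))) => i.
do 2!apply: lin_bigsum => ?; apply: lin_scale.
apply: (lin_comp (f := tens _)); first exact: tens_linr.
exact: epart_linear.
Qed.

Lemma id_tensE b c d x a : homog_derivation gA *%R b d -> homog gU c x ->
  phi d (tens x a) = (-1) ^+ (b && c) *: tens x (d a).
Proof. by case=> ld dd _ hx; apply: (id_tens_pure hgU a hgA ld dd hx). Qed.

Lemma homog_derivation_id_tens b d :
  homog_derivation gA *%R b d -> homog_derivation gT brT b (phi d).
Proof.
move=> hd; have [ld dd Ld] := hd; have lphi := id_tens_lin ld.
have ll := tens_bracket_linl; have lr := tens_bracket_linr.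
split=> //.
- move=> c t; apply: (tens_homog_ext (F := fun t => gT (b (+) c) (phi d t)) (F' := phi d)) => //.
    by apply: (lin_comp (f := gT _)) => //; apply: tens_grading_lin.
  move=> e e' x a -> hx ha; rewrite (id_tensE _ hd hx) (linZ (tens_grading_lin _)).
  by congr (_ *: _); rewrite addbCA; apply/(tens_homog hx)/dd.
- move=> c s t hs; move: s hs.
  apply: (tens_homog_ext (F := fun s => phi d (brT s t))
    (F' := fun s => brT (phi d s) t + (-1) ^+ (b && c) *: brT s (phi d t))).
  + by move=> k u v; rewrite ll lphi.
  + by move=> k u v; rewrite lphi !ll; module K.
  move=> e e' x a -> hx ha; move: t; apply: (tens_ext (F := fun t => phi d (brT _ t))
    (F' := fun t => brT (phi d _) t + (-1) ^+ (b && (e (+) e')) *: brT _ (phi d t))).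
  + by move=> k u v; rewrite lr lphi.
  + by move=> k u v; rewrite lphi !lr; module K.
  move=> f f' y c' hy hc.
  rewrite (tens_bracketE _ _ ha hy) (linZ lphi) !(id_tensE _ hd hx) (id_tensE _ hd hy).
  rewrite (id_tensE _ hd (lie_deg hU hx hy)) (Ld _ _ _ ha) (linD (tens_linr _)) (linZ (tens_linr _)).
  rewrite (linZ (ll _)) (linZ (lr _)) (tens_bracketE _ _ (dd _ _ ha) hy) (tens_bracketE _ _ ha hy).
  by case: b e e' f {hd ld dd Ld lphi hx ha hy} => [] [] [] [] /=; module K.
Qed.

Lemma id_tens_sum (d : bool -> A -> A) :
  phi (fun a => \sum_(b : bool) d b a) =1 (fun t => \sum_(b : bool) phi (d b) t).
Proof.
move=> t; rewrite big_bool /= -[X in X + _]scale1r -(id_tens_lincomb 1).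
by apply: id_tens_ext => a; rewrite big_bool scale1r.
Qed.

Lemma id_tens_split d : linear d ->
  phi d =1 (fun t => \sum_(b : bool) phi (epart gA b d) t).
Proof.
move=> ld t; rewrite -id_tens_sum; apply: id_tens_ext => a.
exact: (epart_sum hgA).
Qed.

Lemma Der_id_tens d : Der gA *%R d -> Der gT brT (phi d).
Proof.
move=> hd; apply: (Der_ext hPT (fun t => esym (id_tens_split (Der_linear hPA hd) t))).
apply: (Der_sum hPT) => b; apply: (Der_homog hPT (b := b)).
exact: homog_derivation_id_tens (Der_epart hPA b hd).
Qed.

Lemma epart_id_tens b d : Der gA *%R d -> epart gT b (phi d) =1 phi (epart gA b d).
Proof.
move=> hd t; pose p c := phi (epart gA c d).
have [l0 d0 _] := homog_derivation_id_tens (Der_epart hPA false hd).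
have [l1 d1 _] := homog_derivation_id_tens (Der_epart hPA true hd).
rewrite (@epart_ext _ _ gT _ _ (fun t => 1 *: p true t + p false t)); last first.
  by move=> v; rewrite (id_tens_split (Der_linear hPA hd)) big_bool scale1r.
rewrite (epart_lincomb hgT) (epart_pure hgT b l0 d0) (epart_pure hgT b l1 d1).
by rewrite scale1r; case: b => /=; rewrite ?addr0 ?add0r.
Qed.

Lemma id_tens_bracket d e : Der gA *%R d -> Der gA *%R e ->
  phi (sbracket gA d e) =1 sbracket gT (phi d) (phi e).
Proof.
move=> hd he t; rewrite /sbracket id_tens_sum; apply: eq_bigr => a _.
rewrite id_tens_sum; apply: eq_bigr => b _.
rewrite !epart_id_tens //.
have da := Der_epart hPA a hd; have eb := Der_epart hPA b he.
have [lpd _ _] := homog_derivation_id_tens da.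
have [lpe _ _] := homog_derivation_id_tens eb.
have dab := homog_derivation_bracket hPA da eb.
have [lab _ _] := homog_derivation_id_tens dab.
have [ld dda _] := da; have [le ddb _] := eb.
move: t; apply: (tens_ext lab (F' := fun t => phi (epart gA a d) (phi (epart gA b e) t)
    - (-1) ^+ (a && b) *: phi (epart gA b e) (phi (epart gA a d) t))).
  by move=> k u v; rewrite lpe lpd lpd lpe; module K.
move=> c c' x z hx hz; rewrite (id_tensE _ dab hx).
rewrite (id_tensE _ da hx) (id_tensE _ eb hx) (linZ lpd) (linZ lpe).
rewrite (id_tensE _ da hx) (id_tensE _ eb hx).
rewrite (linB (tens_linr x)) (linZ (tens_linr x)).
by case: a b c {da eb lpd lpe dab lab ld dda le ddb hx} => [] [] [] /=; module K.
Qed.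

(** Right multiplication by [A]; brackets [brT t] commute with it without signs, because
    they act on the other side. *)
Definition tens_mulr (a : A) (t : T) : T := [ffun i => t i * a].

Lemma tens_mulrE a x b : tens_mulr a (tens x b) = tens x (b * a).
Proof. by apply/ffunP => i; rewrite !ffunE scalerAl. Qed.

Lemma tens_mulr_bracket a t s : brT t (tens_mulr a s) = tens_mulr a (brT t s).
Proof.
have lR : linear (tens_mulr a).
  by move=> k u v; apply/ffunP => i; rewrite !ffunE mulrDl scalerAl.
rewrite /brT /tens_bracket !(lin_sum lR); apply: eq_bigr => i _.
rewrite !(lin_sum lR); apply: eq_bigr => j _.
rewrite !(lin_sum lR); apply: eq_bigr => c _.
rewrite !(lin_sum lR); apply: eq_bigr => d _.
by rewrite (linZ lR) tens_mulrE ffunE mulrA.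
Qed.

Lemma tens_inj x a : x != 0 -> @tens K U A x a = 0 -> a = 0.
Proof.
move=> x0 e; apply/eqP; apply: contraNT x0 => a0.
rewrite (coord_vbasis (memvf x)) big1 // => i _.
move/ffunP/(_ i): e; rewrite !ffunE => /eqP.
by rewrite scaler_eq0 (negPf a0) orbF => /eqP ->; rewrite scale0r.
Qed.

(** No sign occurs on an even [x], so [d] need not be homogeneous, and [d] can be read off from
    [id_tens gU gA d]. *)
Lemma id_tens_even d x a :
  linear d -> homog gU false x -> phi d (tens x a) = tens x (d a).
Proof.
move=> ld hx; rewrite (id_tens_split ld) [in RHS](epart_sum hgA a ld).
rewrite (lin_sum (tens_linr x)); apply: eq_bigr => b _.
rewrite /phi (id_tens_pure hgU a hgA (epart_linear b hgA ld) (epart_degree hgA b ld) hx).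
by rewrite andbF scale1r.
Qed.

Theorem id_tens_lie_embedding x : homog gU false x -> x != 0 ->
  lie_embedding gA gT (Der gA *%R) phi.
Proof.
move=> hx x0; split=> [a d e _ _|b d hd t|d e hd he|d hd d0 a].
- exact: id_tens_lincomb.
- by rewrite epart_id_tens.
- exact: id_tens_bracket.
- apply: (tens_inj x0); rewrite -id_tens_even ?d0 //.
  exact: (Der_linear hPA hd).
Qed.

(** Everything but the decomposition of derivations holds for any Lie superalgebra [U]. *)
Theorem tens_semidirect :
  (forall b D, homog_derivation gT brT b D ->
     exists t d, homog_derivation gA *%R b d /\
       D =1 (fun w => brT t w + phi d w)) ->
  semidirect gT (Der gT brT) (ad brT) (image_of (Der gA *%R) phi).
Proof.
move=> core; split.
- split; [split|move=> f [t e]|move=> f h hf [t e]].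
  + by exists 0 => w; rewrite (br0l hPT).
  + move=> a f h [t et] [s es]; exists (a *: t + s) => w.
    by rewrite et es (brDl hPT) (brZl hPT).
  + move=> b f [t e]; exists (gT b t) => w.
    by rewrite (epart_ext gT b e) (epart_ad hT).
  + by apply: (Der_ext hPT (fun w => esym (e w))); apply: Der_ad.
  + exists (f t) => w; rewrite -(sbracket_ad hT t hf).
    exact: (sbracket_ext gT (fun _ => erefl) e w).
- split; [split|move=> f [d hd e]|move=> f h [d hd ed] [d' hd' ed']].
  + exists (fun=> 0); first exact: (Der_homog hPA (homog_derivation0 hPA false)).
    move=> t; rewrite /phi /id_tens big1 // => i _; rewrite big1 // => b _.
    rewrite big1 // => c _; rewrite /epart big1 ?(lin0 (tens_linr _)) ?scaler0 //.
    by move=> c' _; rewrite (lin0 (gr_lin hgA _)).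
  + move=> a f h [d hd ed] [d' hd' ed'].
    exists (fun x => a *: d x + d' x); first exact: (Der_lincomb hPA).
    by move=> t; rewrite id_tens_lincomb ed ed'.
  + move=> b f [d hd e]; exists (epart gA b d).
      exact: (Der_homog hPA (Der_epart hPA b hd)).
    by move=> t; rewrite (epart_ext gT b e) epart_id_tens.
  + by apply: (Der_ext hPT (fun w => esym (e w))); apply: Der_id_tens.
  + exists (sbracket gA d d'); first exact: (Der_bracket hPA).
    by move=> t; rewrite id_tens_bracket //; apply: sbracket_ext.
- move=> f /(DerE hPT)[f0 [f1 [h0 h1 e]]].
  have [t0 [d0 [k0 e0]]] := core _ _ h0; have [t1 [d1 [k1 e1]]] := core _ _ h1.
  exists (brT (t0 + t1)), (phi (fun a => 1 *: d0 a + d1 a)); split.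
  + by exists (t0 + t1).
  + exists (fun a => 1 *: d0 a + d1 a) => //.
    by apply: (Der_lincomb hPA); [apply: (Der_homog hPA k0)|apply: (Der_homog hPA k1)].
  + by move=> w; rewrite e e0 e1 id_tens_lincomb (brDl hPT); module K.
- move=> f [t et] [d hd ed] w; rewrite et; move: w.
  have lt := tens_linr; have ld := Der_linear hPA hd.
  apply: (tens_ext (F' := fun=> 0)); first exact: tens_bracket_linr.
    by move=> k u v; rewrite scaler0 addr0.
  move=> c e x a hx ha; rewrite -[a]mul1r -tens_mulrE tens_mulr_bracket -et ed.
  rewrite (id_tens_split ld) big1 => [|b _].
    by apply/ffunP => i; rewrite !ffunE mul0r.
  have db := Der_epart hPA b hd; rewrite (id_tensE _ db hx).
  by rewrite (homog_derivation1 hA db) (lin0 (lt x)) scaler0.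
Qed.

End TensorLie.

(** * Forms, the maps E(u,v) and dual families *)

Section Forms.
Variables (K : fieldType) (V : vectType K) (g : bool -> V -> V) (q : V -> V -> K).
Hypotheses (hg : is_grading g) (hq : quadratic_form g q).

Lemma qDr u x y : q u (x + y) = q u x + q u y.
Proof. by case: hq => l _ _ _; have := l u 1 x y; rewrite scale1r mul1r. Qed.
Lemma qDl u x y : q (x + y) u = q x u + q y u.
Proof. by case: hq => _ l _ _; have := l u 1 x y; rewrite /= scale1r mul1r. Qed.
Lemma q0r u : q u 0 = 0.
Proof. by case: hq => l _ _ _; have := l u (-1) 0 0; rewrite scaler0 addr0 mulN1r addNr. Qed.
Lemma q0l u : q 0 u = 0.
Proof.
by case: hq => _ l _ _; have := l u (-1) 0 0; rewrite /= scaler0 addr0 mulN1r addNr.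
Qed.
Lemma qZr u a x : q u (a *: x) = a * q u x.
Proof. by case: hq => l _ _ _; have := l u a x 0; rewrite q0r !addr0. Qed.
Lemma qZl u a x : q (a *: x) u = a * q x u.
Proof. by case: hq => _ l _ _; have := l u a x 0; rewrite /= q0l !addr0. Qed.
Lemma qNr u x : q u (- x) = - q u x.
Proof. by rewrite -scaleN1r qZr mulN1r. Qed.
Lemma qNl u x : q (- x) u = - q x u.
Proof. by rewrite -scaleN1r qZl mulN1r. Qed.
Lemma qBr u x y : q u (x - y) = q u x - q u y.
Proof. by rewrite qDr qNr. Qed.
Lemma qBl u x y : q (x - y) u = q x u - q y u.
Proof. by rewrite qDl qNl. Qed.
Lemma q_sumr u (I : Type) (r : seq I) (P : pred I) (F : I -> V) :
  q u (\sum_(i <- r | P i) F i) = \sum_(i <- r | P i) q u (F i).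
Proof. exact: (big_morph (q u) (qDr u) (q0r u)). Qed.
Lemma q_suml u (I : Type) (r : seq I) (P : pred I) (F : I -> V) :
  q (\sum_(i <- r | P i) F i) u = \sum_(i <- r | P i) q (F i) u.
Proof. exact: (big_morph (q^~ u) (qDl u) (q0l u)). Qed.

Lemma q_degree a b u v : homog g a u -> homog g b v ->
  q u v = (a == b)%:R * q u v.
Proof.
case: hq => _ _ d _ hu hv; case: eqP => [_|/eqP ab]; first by rewrite mul1r.
by rewrite mul0r; apply: d hu hv ab.
Qed.

Lemma q_sym a b u v : homog g a u -> homog g b v ->
  q u v = (-1) ^+ (a && b) * q v u.
Proof. by case: hq => _ _ _; apply. Qed.

(** Only vectors of the same degree pair nontrivially, so one of the two degrees suffices in the
    sign. *)
Lemma q_sym_diag a b u v : homog g a u -> homog g b v ->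
  q u v = (-1) ^+ a * q v u.
Proof.
move=> hu hv; rewrite (q_degree hu hv) (q_degree hv hu) (q_sym hu hv).
by case: a b {hu hv} => [] [] /=; ring.
Qed.

(** For homogeneous [u, v] the sign no longer depends on the argument [p]: the component of [p] that
    [q u] sees has the degree of [u]. *)
Lemma EmapE a b u v p : homog g a u -> homog g b v ->
  Emap g q u v p = q v p *: u - ((-1) ^+ (a && b) * q u p) *: v.
Proof.
move=> hu hv; rewrite /Emap; congr (_ - _).
rewrite (bigD1 b) //= [X in _ + X]big1 => [|b' nb]; last first.
  by rewrite big1 // => c _; rewrite (gr_pure hg _ hv) (negPf nb) scaler0.
rewrite addr0 (bigD1 a) //= big1 => [|a' na]; last first.
  rewrite (q_degree hu (gr_homog hg a' p)) eq_sym (negPf na).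
  by rewrite mul0r mulr0 scale0r.
rewrite addr0 andbC [in RHS](gr_sum hg p) q_sumr (bigD1 a) //= big1 ?addr0 ?hv //.
by move=> c nc; rewrite (q_degree hu (gr_homog hg c p)) eq_sym (negPf nc) mul0r.
Qed.

Lemma Emap_linp u v : linear (Emap g q u v).
Proof.
move=> a x y; rewrite /Emap !big_bool /=.
by rewrite !(gr_lin hg) !qDr !qZr; module K.
Qed.
Lemma Emap_linl v p : linear (fun u => Emap g q u v p).
Proof.
by move=> a x y; rewrite /Emap !big_bool /= !qDl !qZl; module K.
Qed.
Lemma Emap_linr u p : linear (fun v => Emap g q u v p).
Proof.
move=> a x y; rewrite /Emap !big_bool /=.
by rewrite !(gr_lin hg) !qDl !qZl; module K.
Qed.

Lemma Emap_degree a b u v : homog g a u -> homog g b v ->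
  of_degree g (a (+) b) (Emap g q u v).
Proof.
move=> hu hv c p hp; rewrite (EmapE _ hu hv) (q_degree hv hp) (q_degree hu hp).
apply: (homogB hg).
  case: (b =P c) => [<-|_]; last by rewrite mul0r scale0r; apply: homog0.
  by rewrite -addbA addbb addbF; apply: homogZ.
case: (a =P c) => [<-|_]; last by rewrite mul0r mulr0 scale0r; apply: homog0.
by rewrite addbC addbA addbb; apply: homogZ.
Qed.

Lemma Emap_sym a b u v p : homog g a u -> homog g b v ->
  Emap g q v u p = - ((-1) ^+ (a && b) *: Emap g q u v p).
Proof.
move=> hu hv; rewrite (EmapE _ hu hv) (EmapE _ hv hu).
by case: a b {hu hv} => [] [] /=; module K.
Qed.

Lemma Emap_skew a b c d u v x y :
  homog g a u -> homog g b v -> homog g c x -> homog g d y ->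
  q (Emap g q u v x) y + (-1) ^+ (c && d) * q (Emap g q u v y) x = 0.
Proof.
move=> hu hv hx hy; rewrite !(EmapE _ hu hv) !qBl !qZl.
rewrite (q_degree hv hx) (q_degree hu hx) (q_degree hv hy) (q_degree hu hy).
by case: a b c d {hu hv hx hy} => [] [] [] [] /=; ring.
Qed.

(** Skewness of [x] turns the term [q v (x p)] of the commutator into [q (x v) p] up to sign, so
    that [x] acts on [E(u,v)] as on a product of [u] and [v]. *)
Lemma Emap_bracket s a b x u v p :
  linear x -> of_degree g s x ->
  (forall c d w z, homog g c w -> homog g d z ->
      q (x w) z + (-1) ^+ (c && d) * q (x z) w = 0) ->
  homog g a u -> homog g b v ->
  x (Emap g q u v p) - (-1) ^+ (s && (a (+) b)) *: Emap g q u v (x p)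
   = Emap g q (x u) v p + (-1) ^+ (s && a) *: Emap g q u (x v) p.
Proof.
move=> lx dx ox hu hv; move: p; apply: (eq_of_homog hg
  (f := fun p => x (Emap g q u v p) - (-1) ^+ (s && (a (+) b)) *: Emap g q u v (x p))
  (f' := fun p => Emap g q (x u) v p + (-1) ^+ (s && a) *: Emap g q u (x v) p)).
- by move=> k y z; rewrite Emap_linp !lx Emap_linp; module K.
- by move=> k y z; rewrite !Emap_linp; module K.
move=> c p hp; rewrite (EmapE _ hu hv) (EmapE _ (dx _ _ hu) hv) (EmapE _ hu (dx _ _ hv)).
rewrite (EmapE _ hu hv) (linB lx) !(linZ lx).
have adj d w : homog g d w -> q w (x p) = - (-1) ^+ (s && d) * q (x w) p.
  move=> hw; rewrite (q_sym hw (dx _ _ hp)).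
  have /eqP := ox _ _ _ _ hw hp; rewrite addr_eq0 => /eqP ->.
  rewrite (q_degree (dx _ _ hp) hw).
  by case: s c d {hw dx hp} => [] [] [] /=; ring.
rewrite (adj _ _ hu) (adj _ _ hv).
by case: s a b {dx hu hv adj} => [] [] [] /=; module K.
Qed.

Hypothesis hnd : Defs.nondegenerate q.

(** By nondegeneracy [u |-> q u] is an injection of [V] into its dual, hence onto. *)
Lemma form_represents (phi : V -> K) : scalar phi -> exists y, forall v, q y v = phi v.
Proof.
move=> lphi; have lq u : linear (q u : V -> K^o) by move=> a x y; rewrite qDr qZr.
pose Q u : 'Hom(V, K^o) := linfun (q u : V -> K^o).
have QE u v : Q u v = q u v.
  pose Lq := HB.pack_for {linear V -> K^o} (q u : V -> K^o)
    (GRing.isLinear.Build _ _ _ _ _ (lq u)).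
  by rewrite /Q -[q u in LHS]/(Lq : V -> K^o) lfunE.
have lQ : linear Q.
  by move=> a u v; apply/lfunP => p; rewrite add_lfunE scale_lfunE !QE qDl qZl.
pose LQ := HB.pack_for {linear V -> 'Hom(V, K^o)} Q (GRing.isLinear.Build _ _ _ _ _ lQ).
have ker0 : lker (linfun LQ) == 0%VS.
  apply/eqP/vspaceP => u; rewrite memv_ker memv0 lfunE /=; apply/eqP/eqP => [Qu|->].
    by apply: hnd => v; rewrite -QE Qu lfunE.
  exact: (lin0 lQ).
have surj : limg (linfun LQ) = fullv.
  apply/eqP; rewrite eqEdim subvf limg_dim_eq ?(eqP ker0) ?capv0 //.
  by rewrite !dimvf /dim /= muln1.
pose Lphi := HB.pack_for {linear V -> K^o} (phi : V -> K^o)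
    (GRing.isLinear.Build _ _ _ _ _ (lphi : linear (phi : V -> K^o))).
have : linfun Lphi \in limg (linfun LQ) by rewrite surj memvf.
case/memv_imgP => y _ e; exists y => v.
by rewrite -QE -[Q y]/(LQ y) -[LQ y]lfunE -e lfunE.
Qed.

(** These families do what a homogeneous basis and its dual basis would do.  Not asking that they
    be free makes them immediate to construct (the components of any basis) and lets them be
    projected to a subspace. *)
Lemma exists_frame : exists (I : finType) (p : I -> bool) (x y : I -> V),
  [/\ forall i, homog g (p i) (x i), forall i, homog g (p i) (y i)
    & forall v, v = \sum_i q (y i) v *: x i].
Proof.
pose n := \dim {:V}; pose I := ('I_n * bool)%type.
pose x (i : I) := g i.2 (vbasis {:V})`_i.1.
have /fin_all_exists[y hy] (i : I) : exists y, homog g i.2 y /\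
    forall v, q y v = coord (vbasis {:V}) i.1 (g i.2 v).
  have [|y hy] := @form_represents (fun v => coord (vbasis {:V}) i.1 (g i.2 v)).
    by move=> a u v; rewrite (gr_lin hg) linearP.
  exists (g i.2 y); split=> [|v]; first exact: gr_homog.
  rewrite [v in LHS](gr_sum hg) q_sumr (bigD1 i.2) //= big1 => [|c nc].
    rewrite addr0 (form_part hg hq _ _ (gr_homog hg _ v)) eqxx hy.
    by rewrite (gr_homog hg).
  by rewrite (form_part hg hq _ _ (gr_homog hg _ v)) eq_sym (negPf nc).
exists I, (fun i => i.2), x, y; split=> [i|i|v]; first exact: gr_homog.
  by case: (hy i).
have E b : g b v = \sum_i coord (vbasis {:V}) i (g b v) *: g b (vbasis {:V})`_i.
  have h : g b (g b v) = g b v := gr_homog hg b v; rewrite -{1}h.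
  set w := g b v; rewrite {1}(coord_vbasis (memvf w)) (lin_sum (gr_lin hg b)).
  by apply: eq_bigr => i _; rewrite (linZ (gr_lin hg b)).
rewrite {1}[v](gr_sum hg); under eq_bigr => b _ do rewrite E.
rewrite exchange_big pair_big /=; apply: eq_bigr => i _.
by case: (hy i) => _ ->.
Qed.

End Forms.

(** * The orthosymplectic Lie superalgebra *)

Lemma in_span_fin (K : fieldType) (W : lmodType K) (S : (W -> W) -> Prop)
    (I : finType) (c : I -> K) (F : I -> W -> W) f :
  (forall i, S (F i)) -> f =1 (fun w => \sum_i c i *: F i w) -> in_span S f.
Proof.
move=> hF e; exists #|I|, (fun i => c (enum_val i)), (fun i => F (enum_val i)).
split=> [i|w]; first exact: hF.
rewrite e (reindex (@enum_val I I)) //.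
by exists enum_rank => i _; rewrite (enum_valK, enum_rankK).
Qed.

Lemma sbracket_homog (K : fieldType) (W : lmodType K) (g : bool -> W -> W) a b f h w :
  is_grading g -> linear f -> linear h -> of_degree g a f -> of_degree g b h ->
  sbracket g f h w = f (h w) - (-1) ^+ (a && b) *: h (f w).
Proof.
move=> hg lf lh df dh; rewrite /sbracket (bigD1 a) //= [X in _ + X]big1 => [|c nc].
  rewrite addr0 (bigD1 b) //= big1 => [|c nc]; rewrite ?addr0.
    by rewrite !(epart_pure hg _ lf df) !(epart_pure hg _ lh dh) !eqxx.
  rewrite !(epart_pure hg _ lf df) !(epart_pure hg _ lh dh) (negPf nc).
  by rewrite (lin0 lf) eqxx scaler0 subr0.
rewrite big1 // => d _; rewrite !(epart_pure hg _ lf df) (negPf nc) add0r.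
by rewrite !(epart_pure hg _ lh dh) (lin0 lh) if_same scaler0 oppr0.
Qed.

Lemma linfunE (K : fieldType) (U V : vectType K) (f : U -> V) :
  linear f -> linfun f =1 f.
Proof.
move=> lf v; pose F := HB.pack_for {linear U -> V} f (GRing.isLinear.Build _ _ _ _ _ lf).
by rewrite -[f]/(F : U -> V) lfunE.
Qed.

Section Osp.
Variables (K : fieldType) (V : vectType K) (g : bool -> V -> V) (q : V -> V -> K).
Hypotheses (hg : is_grading g) (hq : quadratic_form g q).
Hypothesis hnd : Defs.nondegenerate q.
Hypothesis K2 : 2%:R != 0 :> K.

Lemma osp_lincomb a (f h : 'End(V)) : osp g q f -> osp g q h -> osp g q (a *: f + h).
Proof.
move=> hf hh b c u v hu hv; rewrite !add_lfunE !scale_lfunE !(qDl hq) !(qZl hq).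
transitivity (a * (q (f u) v + (-1) ^+ (b && c) * q (f v) u)
  + (q (h u) v + (-1) ^+ (b && c) * q (h v) u)); first by ring.
by rewrite (hf _ _ _ _ hu hv) (hh _ _ _ _ hu hv) mulr0 addr0.
Qed.

Lemma osp0 : osp g q 0.
Proof. by move=> b c u v hu hv; rewrite !lfunE /= !(q0l hq) mulr0 addr0. Qed.

Lemma osp_sum (I : finType) (c : I -> K) (F : I -> 'End(V)) :
  (forall i, osp g q (F i)) -> osp g q (\sum_i c i *: F i).
Proof.
move=> hF; rewrite /index_enum; elim: (Finite.enum _) => [|i r IH].
  by rewrite big_nil; apply: osp0.
by rewrite big_cons; apply: osp_lincomb.
Qed.

Lemma Emap_osp u v : osp g q (linfun (Emap g q u v)).
Proof.
suff -> : linfun (Emap g q u v) =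
    \sum_(i : bool * bool) 1 *: linfun (Emap g q (g i.1 u) (g i.2 v)).
  apply: osp_sum => i a b x y hx hy; rewrite !(linfunE (Emap_linp hg hq _ _)).
  exact: (Emap_skew hg hq (gr_homog hg _ u) (gr_homog hg _ v) hx hy).
apply/lfunP => p; rewrite sum_lfunE (linfunE (Emap_linp hg hq _ _)).
rewrite [u in LHS](gr_sum hg) (lin_sum (Emap_linl hq _ _)).
under eq_bigr => a _ do
  rewrite {1}[v](gr_sum hg) (lin_sum (Emap_linr hg hq _ _)).
by rewrite pair_big; apply: eq_bigr => i _; rewrite scale1r (linfunE (Emap_linp hg hq _ _)).
Qed.

Section Frame.
Variables (I : finType) (p : I -> bool) (x y : I -> V).
Hypothesis hx : forall i, homog g (p i) (x i).
Hypothesis hy : forall i, homog g (p i) (y i).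
Hypothesis xyE : forall v, v = \sum_i q (y i) v *: x i.

(** Expanding the second argument of [q w] shows that both sides pair equally with every vector. *)
Lemma dual_frame w : w = \sum_i q w (x i) *: y i.
Proof.
apply/eqP; rewrite -subr_eq0; apply/eqP; apply: hnd => v; rewrite (qBl hq).
rewrite {1}[v]xyE (q_sumr hq) (q_suml hq) -sumrB big1 // => i _.
by rewrite (qZr hq) (qZl hq) mulrC subrr.
Qed.

(** The terms [q (y i) v *: f (x i)] of [E(f x_i, y_i)] add up to [f v] by linearity; skewness
    rewrites the other terms as [q (f v) (x i) *: y i], and these add up to [f v] as well. *)
Lemma homog_skew_Emaps s (f : V -> V) v : linear f -> of_degree g s f ->
  (forall a b u w, homog g a u -> homog g b w ->
     q (f u) w + (-1) ^+ (a && b) * q (f w) u = 0) ->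
  2%:R *: f v = \sum_i Emap g q (f (x i)) (y i) v.
Proof.
move=> lf df of_; move: v; apply: (eq_of_homog hg (f := fun v => 2%:R *: f v)
  (f' := fun v => \sum_i Emap g q (f (x i)) (y i) v)).
- exact: lin_scale.
- by apply: lin_bigsum => i; apply: Emap_linp.
move=> c v hv; rewrite -[2%:R]/(1 + 1 : K) scalerDl scale1r {1}[v]xyE (lin_sum lf).
rewrite {1}[f v]dual_frame -big_split; apply: eq_bigr => i _ /=.
rewrite (EmapE hg hq _ (df _ _ (hx i)) (hy i)) (linZ lf); congr (_ + _).
rewrite -scaleNr; congr (_ *: _).
have /eqP := of_ _ _ _ _ (hx i) hv; rewrite addr_eq0 => /eqP ->.
rewrite (q_degree hq (df _ _ hv) (hx i)).
by case: s c (p i) {df hv} => [] [] [] /=; ring.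
Qed.

Lemma osp_Emaps (f : 'End(V)) v : osp g q f ->
  2%:R *: f v = \sum_i Emap g q (f (x i)) (y i) v.
Proof.
move=> of_; have lf := @linearP _ _ _ _ f.
have E (s : bool) : 2%:R *: epart g s f v = \sum_i Emap g q (epart g s f (x i)) (y i) v.
  apply: (homog_skew_Emaps _ (epart_linear s hg lf) (epart_degree hg s lf)).
  move=> a b u w hu hw; have := osp_part hg hq s of_ hu hw.
  by rewrite !(linfunE (epart_linear s hg lf)).
rewrite (epart_sum hg _ lf) scaler_sumr; under eq_bigr => s _ do rewrite E.
rewrite exchange_big; apply: eq_bigr => i _.
by rewrite (epart_sum hg (x i) lf) (lin_sum (Emap_linl hq _ _)).
Qed.

End Frame.

Theorem eosp_eq_osp f : eosp g q f <-> osp g q f.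
Proof.
split=> [[k [c [F [hF e]]]]|of_].
  have {hF}/fin_all_exists[u hu] := hF; have /fin_all_exists[v hv] := hu.
  have -> : f = \sum_i c i *: linfun (Emap g q (u i) (v i)).
    apply/lfunP => w; rewrite e sum_lfunE; apply: eq_bigr => i _.
    by rewrite scale_lfunE (linfunE (Emap_linp hg hq _ _)) hv.
  by apply: osp_sum => i; apply: Emap_osp.
have [I [p [x [y [hx hy xyE]]]]] := exists_frame hg hq hnd.
apply: (@in_span_fin _ _ _ I (fun=> 2%:R^-1) (fun i => Emap g q (f (x i)) (y i))).
  by move=> i; exists (f (x i)), (y i).
move=> v; rewrite -scaler_sumr -(osp_Emaps hx hy xyE v of_).
by rewrite scalerA mulVf // scale1r.
Qed.

Section Subalgebra.
Variable L : {vspace 'End(V)}.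
Hypothesis hL : forall x, x \in L <-> osp g q x.
Let gL := sub_grading g (L := L).
Let brL := sub_bracket g (L := L).
Implicit Types X Y Z : subvs_of L.

Let oL X : osp g q (vsval X). Proof. exact/hL/subvsP. Qed.
Let lX X : linear (vsval X). Proof. exact: linearP. Qed.

Lemma subvs_ext X Y : (forall v, vsval X v = vsval Y v) -> X = Y.
Proof. by move=> e; apply/val_inj/lfunP. Qed.

Lemma vsval_lin a X Y v : vsval (a *: X + Y) v = a *: vsval X v + vsval Y v.
Proof. by rewrite linearP add_lfunE scale_lfunE. Qed.

Lemma vsval_gL b X v : vsval (gL b X) v = epart g b (vsval X) v.
Proof. by apply: vsval_sub_grading => //; apply/hL/osp_part. Qed.

Lemma vsval_brL X Y v : vsval (brL X Y) v = sbracket g (vsval X) (vsval Y) v.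
Proof. by apply: vsval_sub_bracket => //; apply/hL/osp_bracket. Qed.

Lemma sub_is_grading : is_grading gL.
Proof.
split.
- move=> b a X Y; apply: subvs_ext => v; rewrite vsval_lin !vsval_gL -epart_lincomb //.
  by apply: epart_ext => w; rewrite vsval_lin.
- move=> X; apply: subvs_ext => v; rewrite -[gL false X]scale1r vsval_lin !vsval_gL.
  by rewrite [in RHS](epart_sum hg v (lX X)) big_bool scale1r addrC.
- move=> b c X; apply: subvs_ext => v; rewrite vsval_gL.
  rewrite (epart_ext g b (vsval_gL c X)).
  rewrite (epart_pure hg b (epart_linear c hg (lX X)) (epart_degree hg c (lX X))).
  by case: eqP => _; rewrite ?vsval_gL // raddf0 lfunE.
Qed.

Lemma homog_subP b X : homog gL b X <-> of_degree g b (vsval X).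
Proof.
split=> [h|h].
  by move=> c w hw; rewrite -h vsval_gL; apply: (epart_degree hg b (lX X) hw).
by apply: subvs_ext => v; rewrite vsval_gL (epart_pure hg b (lX X) h) eqxx.
Qed.

Lemma vsval_br_homog a b X Y v : homog gL a X -> homog gL b Y ->
  vsval (brL X Y) v = vsval X (vsval Y v) - (-1) ^+ (a && b) *: vsval Y (vsval X v).
Proof.
move=> /homog_subP hX /homog_subP hY; rewrite vsval_brL.
exact: (sbracket_homog v hg (lX X) (lX Y) hX hY).
Qed.

Lemma sub_lie_super : lie_super gL brL.
Proof.
have hgL := sub_is_grading.
have lr X : linear (brL X).
  move=> a Y Z; apply: subvs_ext => v; rewrite vsval_lin !vsval_brL /sbracket.
  rewrite scaler_sumr -big_split; apply: eq_bigr => b _ /=.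
  rewrite scaler_sumr -big_split; apply: eq_bigr => c _ /=.
  have e w : epart g c (vsval (a *: Y + Z)) w
      = a *: epart g c (vsval Y) w + epart g c (vsval Z) w.
    by rewrite -(epart_lincomb hg); apply: epart_ext => u; rewrite vsval_lin.
  by rewrite !e (epart_linear b hg (lX X)); module K.
have ll Y : linear (brL^~ Y).
  move=> a X Z; apply: subvs_ext => v; rewrite vsval_lin !vsval_brL /sbracket.
  rewrite scaler_sumr -big_split; apply: eq_bigr => b _ /=.
  rewrite scaler_sumr -big_split; apply: eq_bigr => c _ /=.
  have e w : epart g b (vsval (a *: X + Z)) w
      = a *: epart g b (vsval X) w + epart g b (vsval Z) w.
    by rewrite -(epart_lincomb hg); apply: epart_ext => u; rewrite vsval_lin.
  by rewrite !e (epart_linear c hg (lX Y)); module K.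
have dg a b X Y : homog gL a X -> homog gL b Y -> homog gL (a (+) b) (brL X Y).
  move=> hX hY; apply/homog_subP => c w hw; rewrite (vsval_br_homog _ hX hY).
  move/homog_subP in hX; move/homog_subP in hY.
  apply: (homogB hg); first by rewrite -addbA; apply/hX/hY.
  by apply: (homogZ hg); rewrite (addbC a) -addbA; apply/hY/hX.
split=> //.
- move=> a b X Y hX hY; apply: subvs_ext => v; rewrite -scaleN1r.
  rewrite -[_ *: _]addr0 vsval_lin -[(-1) ^+ _ *: _ in RHS]addr0 vsval_lin.
  rewrite (vsval_br_homog _ hX hY) (vsval_br_homog _ hY hX) raddf0 lfunE /=.
  by case: a b {hX hY} => [] [] /=; module K.
- move=> a b X Y Z hX hY; move: Z; apply: (eq_of_homog hgL
    (f := fun Z => brL X (brL Y Z))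
    (f' := fun Z => brL (brL X Y) Z + (-1) ^+ (a && b) *: brL Y (brL X Z))).
  + by move=> k u v; rewrite !lr.
  + by move=> k u v; rewrite !lr; module K.
  move=> c Z hZ; apply: subvs_ext => v; rewrite addrC vsval_lin.
  rewrite (vsval_br_homog _ hX (dg _ _ _ _ hY hZ)).
  rewrite (vsval_br_homog _ (dg _ _ _ _ hX hY) hZ).
  rewrite (vsval_br_homog _ hY (dg _ _ _ _ hX hZ)).
  rewrite !(vsval_br_homog _ hY hZ) !(vsval_br_homog _ hX hY) !(vsval_br_homog _ hX hZ).
  rewrite !(linB (lX _)) !(linZ (lX _)).
  by case: a b c {hX hY hZ} => [] [] [] /=; module K.
Qed.

Definition Eosp (u v : V) : subvs_of L := vsproj L (linfun (Emap g q u v)).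

Lemma vsval_Eosp u v p : vsval (Eosp u v) p = Emap g q u v p.
Proof.
rewrite /Eosp vsprojK ?(linfunE (Emap_linp hg hq _ _)) //.
exact/hL/Emap_osp.
Qed.

Lemma Eosp_linl v : linear (Eosp^~ v).
Proof.
move=> a x y; apply: subvs_ext => p; rewrite vsval_lin !vsval_Eosp.
exact: (Emap_linl hq).
Qed.

Lemma Eosp_linr u : linear (Eosp u).
Proof.
move=> a x y; apply: subvs_ext => p; rewrite vsval_lin !vsval_Eosp.
exact: (Emap_linr hg hq).
Qed.

Lemma Eosp_homog a b u v : homog g a u -> homog g b v -> homog gL (a (+) b) (Eosp u v).
Proof.
move=> hu hv; apply/homog_subP => c w hw; rewrite vsval_Eosp.
exact: (Emap_degree hg hq hu hv).
Qed.

Lemma Eosp_sym a b u v : homog g a u -> homog g b v ->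
  Eosp v u = - ((-1) ^+ (a && b) *: Eosp u v).
Proof.
move=> hu hv; apply: subvs_ext => p; rewrite -scaleN1r scalerA -[_ *: _]addr0.
rewrite vsval_lin !vsval_Eosp raddf0 lfunE /= addr0 (Emap_sym hg hq p hu hv).
by module K.
Qed.

Lemma br_Eosp s a b X u v : homog gL s X -> homog g a u -> homog g b v ->
  brL X (Eosp u v) = Eosp (vsval X u) v + (-1) ^+ (s && a) *: Eosp u (vsval X v).
Proof.
move=> hX hu hv; apply: subvs_ext => p; rewrite addrC vsval_lin addrC.
rewrite (vsval_br_homog _ hX (Eosp_homog hu hv)) !vsval_Eosp.
apply: (Emap_bracket hg hq p (lX X) _ (oL X) hu hv); exact/homog_subP.
Qed.

(** The expansion of skew maps, read in [L]: the [E(u,v)] span [L]. *)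
Lemma Eosp_span (I : finType) (p : I -> bool) (x y : I -> V) X :
  (forall i, homog g (p i) (x i)) -> (forall i, homog g (p i) (y i)) ->
  (forall v, v = \sum_i q (y i) v *: x i) ->
  X = \sum_i Eosp (2%:R^-1 *: vsval X (x i)) (y i).
Proof.
move=> hx hy xyE; apply: subvs_ext => v; rewrite raddf_sum sum_lfunE.
under eq_bigr => i _ do rewrite /= vsval_Eosp (linZ (Emap_linl hq _ _)).
by rewrite -scaler_sumr -(osp_Emaps hx hy xyE v (oL X)) scalerA mulVf // scale1r.
Qed.

End Subalgebra.
End Osp.

(** * The weights of a rank one torus *)

Lemma eigen_indep (K : fieldType) (M : lmodType K) (F : M -> M) (s : seq (K * M)) :
  linear F -> uniq (unzip1 s) -> (forall p, p \in s -> F p.2 = p.1 *: p.2) ->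
  \sum_(p <- s) p.2 = 0 -> forall p, p \in s -> p.2 = 0.
Proof.
move=> lF; elim: s {-2}s (leqnn (size s)) => [|p0 s0 IH] [|[k v] s] //= hs.
move=> /andP[ks us] hF e.
pose s' := [seq (p.1, (p.1 - k) *: p.2) | p <- s].
have e' : \sum_(p <- s') p.2 = 0.
  rewrite big_map /=; have := congr1 F e; rewrite (lin0 lF) (lin_sum lF) big_cons /=.
  have -> : F v = k *: v by apply: (hF (k, v)); rewrite mem_head.
  rewrite big_cons /= in e; move/eqP: e; rewrite addr_eq0 => /eqP ->.
  rewrite scalerN addrC scaler_sumr -sumrB => e; rewrite -[RHS]e.
  rewrite !big_seq; apply: eq_bigr => p ps.
  by rewrite hF ?inE ?ps ?orbT // scalerBl.
have z p : p \in s -> p.2 = 0.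
  move=> ps; have /eqP : (p.1 - k) *: p.2 = 0.
    apply: (IH s' _ _ _ e' (p.1, (p.1 - k) *: p.2)).
    - by rewrite size_map.
    - by rewrite /unzip1 -map_comp.
    - move=> _ /mapP[r rs ->] /=; rewrite (linZ lF) hF ?inE ?rs ?orbT //.
      by rewrite scalerA mulrC -scalerA.
    - exact: (map_f (fun p => (p.1, (p.1 - k) *: p.2))).
  rewrite scaler_eq0 subr_eq0 => /orP[/eqP pk|/eqP //].
  by case/negP: ks; rewrite -pk; apply: map_f.
move=> p; rewrite inE => /orP[/eqP ->|]; last exact: z.
rewrite big_cons big_seq big1 ?addr0 // in e; exact: e.
Qed.

Section Model.
Variables (K : fieldType) (V : vectType K) (g : bool -> V -> V) (q : V -> V -> K).
Variables (A : algType K) (gA : bool -> A -> A).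
Variables (T : lmodType K) (gT : bool -> T -> T) (br : T -> T -> T).
Variable Th : V -> V -> A -> T.
Let E := Emap g q.

(** [Th u v x] stands for [E(u,v) (x) x].  The record abstracts [osp (x) A] so that [osp] itself,
    with [A = K], is covered by the same proof. *)
Record osp_current : Prop := OspCurrent {
  cur_lie : lie_super gT br;
  cur_lin1 : forall v x, linear (fun u => Th u v x);
  cur_lin2 : forall u x, linear (fun v => Th u v x);
  cur_lin3 : forall u v, linear (Th u v);
  cur_homog : forall a b c u v x, homog g a u -> homog g b v -> homog gA c x ->
    homog gT (a (+) b (+) c) (Th u v x);
  cur_sym : forall a b u v x, homog g a u -> homog g b v ->
    Th v u x = - ((-1) ^+ (a && b) *: Th u v x);
  cur_br : forall a b c d s u v w z x y,
    homog g a u -> homog g b v -> homog g c w -> homog g d z -> homog gA s x ->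
    br (Th u v x) (Th w z y) = (-1) ^+ (s && (c (+) d)) *:
      (Th (E u v w) z (x * y) + (-1) ^+ ((a (+) b) && c) *: Th w (E u v z) (x * y));
  cur_ind : forall P : T -> Prop, P 0 -> (forall s t, P s -> P t -> P (s + t)) ->
    (forall u v x, P (Th u v x)) -> forall t, P t;
  cur_inj : forall u p x, E u u p != 0 -> Th u u x = 0 -> x = 0 }.

(** An odd hyperbolic pair [e, f] together with dual families of the orthogonal complement of
    [<e,f>]. *)
Record hyperbolic_frame (e f : V) (I : finType) (p : I -> bool) (x y : I -> V) : Prop :=
  HyperbolicFrame {
  fr_e : homog g true e;
  fr_f : homog g true f;
  fr_ef : q f e = 1;
  fr_x : forall i, homog g (p i) (x i);
  fr_y : forall i, homog g (p i) (y i);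
  fr_ex : forall i, q e (x i) = 0;
  fr_fx : forall i, q f (x i) = 0;
  fr_ey : forall i, q e (y i) = 0;
  fr_fy : forall i, q f (y i) = 0;
  fr_split : forall u, u = q f u *: e - q e u *: f + \sum_i q (y i) u *: x i;
  fr_dual : forall k, x k = \sum_i q (x k) (x i) *: y i }.

Hypotheses (hg : is_grading g) (hq : quadratic_form g q) (hA : superextension gA).
Hypothesis charK : [pchar K] =i pred0.
Hypothesis hT : osp_current.
Variables (e f : V) (I : finType) (p : I -> bool) (X Y : I -> V).
Hypothesis fr : hyperbolic_frame e f p X Y.

Let hL := cur_lie hT.
Let hPT := lie_product hL.
Let hgT := prod_graded hPT.
Let lr := prod_linr hPT.
Let ll := prod_linl hPT.
Let hgA : is_grading gA. Proof. by case: hA. Qed.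
Let hPA := mulr_graded_product hA.
Let hA1 : homog gA false 1. Proof. by case: hA. Qed.
Let he := fr_e fr.
Let hf := fr_f fr.
Let hX := fr_x fr.
Let hY := fr_y fr.
Let l1 := cur_lin1 hT.
Let l2 := cur_lin2 hT.
Let l3 := cur_lin3 hT.

Let natK n : (n.+1%:R : K) != 0.
Proof. by move/pcharf0P: charK => ->. Qed.

Lemma fr_fe : q e f = -1.
Proof. by rewrite (q_sym hq he hf) (fr_ef fr) mulr1. Qed.

Lemma odd_isotropic u : homog g true u -> q u u = 0.
Proof.
move=> hu; have := q_sym hq hu hu; rewrite expr1 mulN1r => /eqP.
rewrite -addr_eq0 -mulr2n -mulr_natl mulf_eq0 (negPf (natK 1)) /=.
by move/eqP.
Qed.

Lemma q_perp u v a : homog g true u -> homog g a v -> q u v = 0 -> q v u = 0.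
Proof. by move=> hu hv e0; rewrite (q_sym hq hv hu) e0 mulr0. Qed.

Lemma E_odd u v w : homog g true u -> homog g true v -> E u v w = q v w *: u + q u w *: v.
Proof. by move=> hu hv; rewrite /E (EmapE hg hq w hu hv) /=; module K. Qed.

Lemma br_odd_odd u v w z x y : homog g true u -> homog g true v ->
  homog g true w -> homog g true z ->
  br (Th u v x) (Th w z y) = Th (E u v w) z (x * y) + Th w (E u v z) (x * y).
Proof.
move=> hu hv hw hz; move: x; apply: (eq_of_homog hgA (f := fun x => br (Th u v x) (Th w z y))
  (f' := fun x => Th (E u v w) z (x * y) + Th w (E u v z) (x * y))).
- by move=> k a b; rewrite l3 ll.
- by move=> k a b; rewrite (prod_linl hPA) !l3; module K.
move=> s x hx; rewrite (cur_br hT _ hu hv hw hz hx) /= andbF.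
by module K.
Qed.

(** [E(u,v) (x) 1] with [u, v] odd is even, so it acts as an ordinary derivation and no degree has to
    be known. *)
Lemma br_sl2 u v w z y : homog g true u -> homog g true v ->
  br (Th u v 1) (Th w z y) = Th (E u v w) z y + Th w (E u v z) y.
Proof.
move=> hu hv; have lE : linear (E u v) := Emap_linp hg hq u v.
move: w; apply: (eq_of_homog hg (f := fun w => br (Th u v 1) (Th w z y))
  (f' := fun w => Th (E u v w) z y + Th w (E u v z) y)).
- by move=> k a b; rewrite l1 lr.
- by move=> k a b; rewrite lE !l1; module K.
move=> c w hw; move: z; apply: (eq_of_homog hg (f := fun z => br (Th u v 1) (Th w z y))
  (f' := fun z => Th (E u v w) z y + Th w (E u v z) y)).
- by move=> k a b; rewrite l2 lr.
- by move=> k a b; rewrite lE !l2; module K.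
move=> d z hz; rewrite (cur_br hT _ hu hv hw hz hA1) /= mul1r.
by module K.
Qed.

Lemma gT_Th a b s u v x : homog g a u -> homog g b v ->
  gT s (Th u v x) = Th u v (gA (s (+) (a (+) b)) x).
Proof.
move=> hu hv; have lA := gr_lin hgA (s (+) (a (+) b)); have lT := gr_lin hgT s.
move: x; apply: (eq_of_homog hgA (f := fun x => gT s (Th u v x))
  (f' := fun x => Th u v (gA (s (+) (a (+) b)) x))).
- by move=> k x y; rewrite l3 lT.
- by move=> k x y; rewrite lA l3.
move=> c x hx; rewrite (gr_pure hgT _ (cur_homog hT hu hv hx)) (gr_pure hgA _ hx).
have -> : (s (+) (a (+) b) == c) = (s == a (+) b (+) c).
  by clear; case: s a b c => [] [] [] [].
by case: eqP => _; rewrite ?(lin0 (l3 u v)).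
Qed.

(* Up to scalars, [e2, h, f2] is an [sl2] triple. *)
Let h := Th e f 1.
Let e2 := Th e e 1.
Let f2 := Th f f 1.

Lemma EefE u : E e f u = q f u *: e + q e u *: f.
Proof. exact: E_odd. Qed.
Lemma Eef_e : E e f e = e.
Proof. by rewrite EefE (fr_ef fr) (odd_isotropic he); module K. Qed.
Lemma Eef_f : E e f f = - f.
Proof. by rewrite EefE fr_fe (odd_isotropic hf); module K. Qed.
Lemma Eef_X i : E e f (X i) = 0.
Proof. by rewrite EefE (fr_ex fr) (fr_fx fr); module K. Qed.
Lemma Eee_e : E e e e = 0.
Proof. by rewrite E_odd // (odd_isotropic he); module K. Qed.
Lemma Eee_f : E e e f = - (2%:R *: e).
Proof. by rewrite E_odd // fr_fe; module K. Qed.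
Lemma Eff_e : E f f e = 2%:R *: f.
Proof. by rewrite E_odd // (fr_ef fr); module K. Qed.
Lemma Eff_f : E f f f = 0.
Proof. by rewrite E_odd // (odd_isotropic hf); module K. Qed.
Lemma Eff_X i : E f f (X i) = 0.
Proof. by rewrite E_odd // (fr_fx fr); module K. Qed.

Lemma Th_fe x : Th f e x = Th e f x.
Proof. by rewrite (cur_sym hT x he hf) /=; module K. Qed.

Let ThE := (Th_fe, Eef_e, Eef_f, Eef_X, Eee_e, Eee_f, Eff_e, Eff_f, Eff_X).

Lemma Th_injee x : Th e e x = 0 -> x = 0.
Proof.
apply: (cur_inj hT (p := f)); rewrite -/E Eee_f oppr_eq0 scaler_eq0 (negPf (natK 1)) /=.
apply/eqP => e0; have := fr_ef fr; rewrite e0 (q0r hq) => /eqP.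
by rewrite eq_sym oner_eq0.
Qed.

(** As [E(e,f)] fixes [e], negates [f] and kills their orthogonal complement, the weight of
    [Th u v x] is the sum of the weights [1, -1, 0] of [u] and [v]. *)
Definition weight (k : K) (t : T) := br h t = k *: t.

Lemma weight_Th k l u v x : E e f u = k *: u -> E e f v = l *: v ->
  weight (k + l) (Th u v x).
Proof.
move=> eu ev; rewrite /weight br_sl2 // eu ev.
by rewrite (linZ (l1 _ _)) (linZ (l2 _ _)) scalerDl.
Qed.

Lemma weight_lin k a s t : weight k s -> weight k t -> weight k (a *: s + t).
Proof. by rewrite /weight lr => -> ->; module K. Qed.

Lemma weight_sum k (J : finType) (F : J -> T) :
  (forall j, weight k (F j)) -> weight k (\sum_j F j).
Proof.
move=> hF; rewrite /weight (lin_sum (lr h)) scaler_sumr.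
by apply: eq_bigr => j _; apply: hF.
Qed.

Let He : E e f e = 1 *: e. Proof. by rewrite Eef_e scale1r. Qed.
Let Hf : E e f f = (-1) *: f. Proof. by rewrite Eef_f scaleN1r. Qed.
Let HX i : E e f (X i) = 0 *: X i. Proof. by rewrite Eef_X scale0r. Qed.

Lemma weight_ee x : weight 2%:R (Th e e x).
Proof. exact: (weight_Th x He He). Qed.
Lemma weight_eX i x : weight 1 (Th e (X i) x).
Proof. by have := weight_Th x He (HX i); rewrite addr0. Qed.
Lemma weight_ef x : weight 0 (Th e f x).
Proof. by have := weight_Th x He Hf; rewrite subrr. Qed.
Lemma weight_XX i j x : weight 0 (Th (X i) (X j) x).
Proof. by have := weight_Th x (HX i) (HX j); rewrite addr0. Qed.
Lemma weight_fX i x : weight (-1) (Th f (X i) x).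
Proof. by have := weight_Th x Hf (HX i); rewrite addr0. Qed.
Lemma weight_ff x : weight (- 2%:R) (Th f f x).
Proof. by have := weight_Th x Hf Hf; rewrite -opprD. Qed.

(** The general elements of [E(u,V')A] and of [E(V',V')A]. *)
Definition side u (c : I -> A) := \sum_i Th u (X i) (c i).
Definition perp_part (c : I -> I -> A) := \sum_i \sum_j Th (X i) (X j) (c i j).

Lemma weight_decomposition t : exists a b c d b' a',
  t = Th e e a + side e b + (Th e f c + perp_part d) + side f b' + Th f f a'.
Proof.
pose D t := exists a b c d b' a',
  t = Th e e a + side e b + (Th e f c + perp_part d) + side f b' + Th f f a'.
rewrite -/(D t).
have side0 u : side u (fun=> 0) = 0.
  by apply: big1 => i _; apply: (lin0 (l3 _ _)).
have perp0 : perp_part (fun _ _ => 0) = 0.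
  by apply: big1 => i _; apply: big1 => j _; apply: (lin0 (l3 _ _)).
have sideD k u c c' : side u (fun i => k *: c i + c' i) = k *: side u c + side u c'.
  rewrite /side scaler_sumr -big_split; apply: eq_bigr => i _; exact: l3.
have perpD k c c' : perp_part (fun i j => k *: c i j + c' i j) = k *: perp_part c + perp_part c'.
  rewrite /perp_part scaler_sumr -big_split; apply: eq_bigr => i _.
  rewrite /= scaler_sumr -big_split; apply: eq_bigr => j _; exact: l3.
have Dlin k s r : D s -> D r -> D (k *: s + r).
  move=> [a1 [b1 [c1 [d1 [b1' [a1' ->]]]]]] [a2 [b2 [c2 [d2 [b2' [a2' ->]]]]]].
  exists (k *: a1 + a2), (fun i => k *: b1 i + b2 i), (k *: c1 + c2).
  exists (fun i j => k *: d1 i j + d2 i j), (fun i => k *: b1' i + b2' i), (k *: a1' + a2').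
  by rewrite !sideD perpD !l3; module K.
have z u v := lin0 (l3 u v).
have D0 : D 0.
  exists 0, (fun=> 0), 0, (fun _ _ => 0), (fun=> 0), 0.
  by rewrite !z !side0 perp0 !addr0.
have DD s r : D s -> D r -> D (s + r).
  by move=> hs hr; rewrite -[s]scale1r; apply: Dlin.
have DZ k s : D s -> D (k *: s) by move=> hs; rewrite -[_ *: _]addr0; apply: Dlin.
have DN s : D s -> D (- s) by move=> hs; rewrite -scaleN1r; apply: DZ.
have Dee x : D (Th e e x).
  exists x, (fun=> 0), 0, (fun _ _ => 0), (fun=> 0), 0.
  by rewrite !z !side0 perp0 !addr0.
have Def x : D (Th e f x).
  exists 0, (fun=> 0), x, (fun _ _ => 0), (fun=> 0), 0.
  by rewrite !z !side0 perp0 !addr0 !add0r.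
have Dff x : D (Th f f x).
  exists 0, (fun=> 0), 0, (fun _ _ => 0), (fun=> 0), x.
  by rewrite !z !side0 perp0 !addr0 !add0r.
have DeX x : D (side e x).
  exists 0, x, 0, (fun _ _ => 0), (fun=> 0), 0.
  by rewrite !z !side0 perp0 !addr0 !add0r.
have DfX x : D (side f x).
  exists 0, (fun=> 0), 0, (fun _ _ => 0), x, 0.
  by rewrite !z !side0 perp0 !addr0 !add0r.
have DXX x : D (perp_part x).
  exists 0, (fun=> 0), 0, x, (fun=> 0), 0.
  by rewrite !z !side0 !addr0 !add0r.
apply: (cur_ind hT) => // u v x; pose c w i := q (Y i) w.
have sideE w u' : Th w (\sum_i c u' i *: X i) x = side w (fun i => c u' i *: x).
  rewrite (lin_sum (l2 _ _)); apply: eq_bigr => i _.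
  by rewrite (linZ (l2 _ _)) (linZ (l3 _ _)).
have sideE' w u' : homog g true w ->
    Th (\sum_i c u' i *: X i) w x = side w (fun i => - ((-1) ^+ p i * c u' i) *: x).
  move=> hw; rewrite (lin_sum (l1 _ _)); apply: eq_bigr => i _.
  rewrite (linZ (l1 _ _)) (linZ (l3 _ _)) (cur_sym hT _ hw (hX i)) /=.
  by module K.
have perpE : Th (\sum_i c u i *: X i) (\sum_i c v i *: X i) x
    = perp_part (fun i j => (c u i * c v j) *: x).
  rewrite (lin_sum (l1 _ _)); apply: eq_bigr => i _; rewrite (lin_sum (l2 _ _)).
  apply: eq_bigr => j _; rewrite (linZ (l1 _ _)) (linZ (l2 _ _)) (linZ (l3 _ _)).
  by rewrite scalerA.
rewrite (fr_split fr u) (fr_split fr v) -/(c _).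
set u' := \sum_i _ *: _; set v' := \sum_i q (Y i) v *: _.
have -> a b a' b' : Th (a *: e - b *: f + u') (a' *: e - b' *: f + v') x =
    (a * a') *: Th e e x - (a * b' + b * a') *: Th e f x + a *: Th e v' x
    + (b * b') *: Th f f x - b *: Th f v' x + a' *: Th u' e x - b' *: Th u' f x
    + Th u' v' x.
  rewrite !(linD (l1 _ _), linN (l1 _ _), linZ (l1 _ _)).
  rewrite !(linD (l2 _ _), linN (l2 _ _), linZ (l2 _ _)) Th_fe.
  by module K.
rewrite (sideE e v) (sideE f v) (sideE' _ u he) (sideE' _ u hf) perpE.
by do !first [exact: DXX | apply: (DD _ _) | apply: (DN _) | apply: (DZ _ _)].
Qed.


(** The weights are pairwise distinct since their differences are nonzero integers of absolute value
    at most 4. *)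
Lemma weight_indep t2 t1 t0 m1 m2 :
  weight 2%:R t2 -> weight 1 t1 -> weight 0 t0 -> weight (-1) m1 -> weight (- 2%:R) m2 ->
  t2 + t1 + t0 + m1 + m2 = 0 -> [/\ t2 = 0, t1 = 0, t0 = 0, m1 = 0 & m2 = 0].
Proof.
move=> w2 w1 w0 n1 n2 e0.
pose s := [:: (2%:R : K, t2); (1, t1); (0, t0); (-1, m1); (- 2%:R, m2)].
have neq (a b : K) n : a - b = n.+1%:R -> (a == b) = false.
  by move=> ab; rewrite -subr_eq0 ab; apply/negbTE.
have us : uniq (unzip1 s).
  by rewrite /= !inE (neq 2%:R 1 0) ?(neq 2%:R 0 1) ?(neq 2%:R (-1) 2) ?(neq 2%:R (- 2%:R) 3)
    ?(neq 1 0 0) ?(neq 1 (-1) 1) ?(neq 1 (- 2%:R) 2) ?(neq 0 (-1) 0)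
    ?(neq 0 (- 2%:R) 1) ?(neq (-1) (- 2%:R) 0) //; ring.
have hs : forall p, p \in s -> br h p.2 = p.1 *: p.2.
  by move=> r; rewrite !inE => /or4P[||| /orP[]] /eqP ->.
have z := eigen_indep (lr h) us hs _.
have {}z r : r \in s -> r.2 = 0.
  by apply: z; rewrite !big_cons big_nil /= addr0 !addrA.
split; [exact: (z (2%:R, t2) (mem_nth (0, 0) (isT : (0 < size s)%N)))
  | exact: (z (1, t1) (mem_nth (0, 0) (isT : (1 < size s)%N)))
  | exact: (z (0, t0) (mem_nth (0, 0) (isT : (2 < size s)%N)))
  | exact: (z (-1, m1) (mem_nth (0, 0) (isT : (3 < size s)%N)))
  | exact: (z (- 2%:R, m2) (mem_nth (0, 0) (isT : (4 < size s)%N)))].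
Qed.

Lemma weight_side_e c : weight 1 (side e c).
Proof. by apply: weight_sum => i; apply: weight_eX. Qed.
Lemma weight_side_f c : weight (-1) (side f c).
Proof. by apply: weight_sum => i; apply: weight_fX. Qed.
Lemma weight_middle x c : weight 0 (Th e f x + perp_part c).
Proof.
rewrite -[Th e f x]scale1r; apply: weight_lin; first exact: weight_ef.
by apply: weight_sum => i; apply: weight_sum => j; apply: weight_XX.
Qed.

Lemma weight0 k : weight k 0.
Proof. by rewrite /weight (lin0 (lr h)) scaler0. Qed.
Lemma weightZ k a t : weight k t -> weight k (a *: t).
Proof. by move=> wt; rewrite -[_ *: _]addr0; apply: weight_lin (weight0 k). Qed.
Lemma weightB k s t : weight k s -> weight k t -> weight k (s - t).
Proof. by move=> ws wt; rewrite addrC -scaleN1r; apply: weight_lin. Qed.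

Lemma weight2_form t : weight 2%:R t -> exists x, t = Th e e x.
Proof.
have [a [b [c [d [b' [a' ->]]]]]] := weight_decomposition t.
set s := _ + Th f f a' => ws; exists a.
have := weight_indep (weightB (weight_ee a) ws) (weight_side_e b)
  (weight_middle c d) (weight_side_f b') (weight_ff a').
case=> [|/eqP]; first by rewrite /s; module K.
by rewrite subr_eq0 eq_sym => /eqP.
Qed.

Lemma weight1_form t : weight 1 t -> exists b, t = side e b.
Proof.
have [a [b [c [d [b' [a' ->]]]]]] := weight_decomposition t.
set s := _ + Th f f a' => ws; exists b.
have := weight_indep (weight_ee a) (weightB (weight_side_e b) ws)
  (weight_middle c d) (weight_side_f b') (weight_ff a').
case=> [|_ /eqP]; first by rewrite /s; module K.
by rewrite subr_eq0 eq_sym => /eqP.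
Qed.

Lemma weight0_form t : weight 0 t -> exists c d, t = Th e f c + perp_part d.
Proof.
have [a [b [c [d [b' [a' ->]]]]]] := weight_decomposition t.
set s := _ + Th f f a' => ws; exists c, d.
have := weight_indep (weight_ee a) (weight_side_e b)
  (weightB (weight_middle c d) ws) (weight_side_f b') (weight_ff a').
case=> [|_ _ /eqP]; first by rewrite /s; module K.
by rewrite subr_eq0 eq_sym => /eqP.
Qed.

Lemma weightm2_form t : weight (- 2%:R) t -> exists x, t = Th f f x.
Proof.
have [a [b [c [d [b' [a' ->]]]]]] := weight_decomposition t.
set s := _ + Th f f a' => ws; exists a'.
have := weight_indep (weight_ee a) (weight_side_e b)
  (weight_middle c d) (weight_side_f b') (weightB (weight_ff a') ws).
case=> [|_ _ _ _ /eqP]; first by rewrite /s; module K.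
by rewrite subr_eq0 eq_sym => /eqP.
Qed.

(** [ad h] is semisimple, so it is invertible off its kernel: this is what allows [D h] to be moved
    to weight 0 by an inner derivation. *)
Lemma ad_h_cokernel t : exists s, weight 0 (t - br h s).
Proof.
have [a [b [c [d [b' [a' ->]]]]]] := weight_decomposition t.
have half u x : Th u u x = 2%:R *: Th u u (2%:R^-1 *: x).
  by rewrite (linZ (l3 _ _)) scalerA mulfV ?natK // scale1r.
(* Each weight component is divided by its weight. *)
exists (Th e e (2%:R^-1 *: a) + side e b - side f b' - Th f f (2%:R^-1 *: a')).
rewrite !(linB (lr _)) (linD (lr _)).
rewrite (weight_ee _) (weight_side_e b) (weight_side_f b') (weight_ff _).
rewrite (half e a) (half f a').
suff -> : forall x2 x1 x0 y1 y2 : T,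
    2%:R *: x2 + x1 + x0 + y1 + 2%:R *: y2
      - (2%:R *: x2 + 1 *: x1 - (-1) *: y1 - (- 2%:R) *: y2) = x0.
  exact: weight_middle.
by move=> *; module K.
Qed.

(** No generalized eigenvectors: [(2 - ad h)^2 t = 0] implies [(2 - ad h) t = 0]. *)
Lemma weight2_coker t : weight 2%:R (2%:R *: t - br h t) -> weight 2%:R t.
Proof.
have [a [b [c [d [b' [a' ->]]]]]] := weight_decomposition t.
set s := _ + Th f f a'.
have es : 2%:R *: s - br h s = side e b + 2%:R *: (Th e f c + perp_part d) + 3%:R *: side f b' + 4%:R *: Th f f a'.
  have := weight_middle c d; rewrite /s; move: (Th e f c + perp_part d) => M wM.
  rewrite !(linD (lr _)) (weight_ee a) (weight_side_e b) (weight_side_f b') (weight_ff a') wM.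
  by module K.
move=> ws; have := weight_indep (weightZ (-1) ws) (weight_side_e b)
   (weightZ 2%:R (weight_middle c d)) (weightZ 3%:R (weight_side_f b')) (weightZ 4%:R (weight_ff a')).
case=> [|/eqP]; first by rewrite es; module K.
rewrite scaleN1r oppr_eq0 subr_eq0 eq_sym => /eqP es' _ _ _ _; exact: es'.
Qed.

Lemma weightm2_coker t : weight (- 2%:R) (2%:R *: t + br h t) -> weight (- 2%:R) t.
Proof.
have [a [b [c [d [b' [a' ->]]]]]] := weight_decomposition t.
set s := _ + Th f f a'.
have es : 2%:R *: s + br h s = 4%:R *: Th e e a + 3%:R *: side e b + 2%:R *: (Th e f c + perp_part d) + side f b'.
  have := weight_middle c d; rewrite /s; move: (Th e f c + perp_part d) => M wM.
  rewrite !(linD (lr _)) (weight_ee a) (weight_side_e b) (weight_side_f b') (weight_ff a') wM.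
  by module K.
move=> ws; have := weight_indep (weightZ 4%:R (weight_ee a)) (weightZ 3%:R (weight_side_e b))
   (weightZ 2%:R (weight_middle c d)) (weight_side_f b') (weightZ (-1) ws).
case=> [|_ _ _ _ /eqP]; first by rewrite es; module K.
rewrite scaleN1r oppr_eq0 addrC addr_eq0 => /eqP es'; rewrite /weight es'.
by module K.
Qed.


Let hh : homog gT false h := cur_homog hT he hf hA1.
Let he2 : homog gT false e2 := cur_homog hT he he hA1.
Let hf2 : homog gT false f2 := cur_homog hT hf hf hA1.

Lemma gT_br_even b s t : homog gT false s -> gT b (br s t) = br s (gT b t).
Proof.
move=> hs; move: t; apply: (eq_of_homog hgT (f := fun t => gT b (br s t))
  (f' := fun t => br s (gT b t))).
- by move=> k u v; rewrite lr (gr_lin hgT).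
- by move=> k u v; rewrite (gr_lin hgT) lr.
move=> c t ht; rewrite (gr_pure hgT _ (lie_deg hL hs ht)) (gr_pure hgT _ ht) addFb.
by case: eqP => _; rewrite ?(lin0 (lr s)).
Qed.

Lemma br_even_skew s t : homog gT false s -> br t s = - br s t.
Proof.
move=> hs; move: t; apply: (eq_of_homog hgT (f := fun t => br t s) (f' := fun t => - br s t)).
- exact: ll.
- by move=> k u v; rewrite lr; module K.
by move=> c t ht; rewrite (lie_skew hL ht hs) andbF scale1r.
Qed.

Lemma br_perp a b c d u v w z x y : homog g a u -> homog g b v ->
  homog g c w -> homog g d z -> E u v w = 0 -> E u v z = 0 ->
  br (Th u v x) (Th w z y) = 0.
Proof.
move=> hu hv hw hz ew ez; move: x.
apply: (eq_of_homog hgA (f := fun x => br (Th u v x) (Th w z y)) (f' := fun=> 0)).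
- by move=> k x x'; rewrite l3 ll.
- by move=> k x x'; rewrite scaler0 addr0.
move=> s x hx; rewrite (cur_br hT _ hu hv hw hz hx) ew ez.
by rewrite (lin0 (l1 _ _)) (lin0 (l2 _ _)) scaler0 addr0 scaler0.
Qed.

Lemma E_perp a b u v w : homog g a u -> homog g b v -> q u w = 0 -> q v w = 0 -> E u v w = 0.
Proof. by move=> hu hv uw vw; rewrite /E (EmapE hg hq w hu hv) uw vw; module K. Qed.

Lemma Xe i : q (X i) e = 0. Proof. exact: q_perp he (hX i) (fr_ex fr i). Qed.
Lemma Xf i : q (X i) f = 0. Proof. exact: q_perp hf (hX i) (fr_fx fr i). Qed.

Lemma br_perp_part m u x : homog g true u -> (forall i, q (X i) u = 0) ->
  br (perp_part m) (Th u u x) = 0.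
Proof.
move=> hu Xu; rewrite (br_suml hPT) big1 // => i _; rewrite (br_suml hPT) big1 // => j _.
have e0 := E_perp (hX i) (hX j) (Xu i) (Xu j).
exact: (br_perp _ _ (hX i) (hX j) hu hu e0 e0).
Qed.

(** * Normalising a derivation *)

Section Derivation.
Variables (b : bool).
Implicit Types D : T -> T.
Notation hder := (homog_derivation gT br b).

Lemma der_even D s t : hder D -> homog gT false s ->
  D (br s t) = br (D s) t + br s (D t).
Proof. by case=> _ _ LD hs; rewrite (LD _ _ _ hs) andbF scale1r. Qed.

(** [T] is generated by these elements: bracketing [Th e X_i 1] with [Th e f x] gives [Th e X_i x],
    then [f2] moves it to [Th f X_i x], and the brackets [[Th e X_i 1, Th f X_j x]] give
    [Th X_i X_j x] modulo [Th e f A]. *)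
Lemma derivation_eq0 D : hder D ->
  (forall x, D (Th e e x) = 0) -> (forall x, D (Th e f x) = 0) ->
  (forall x, D (Th f f x) = 0) -> (forall i, D (Th e (X i) 1) = 0) -> D =1 (fun=> 0).
Proof.
move=> hD Dee Def Dff DeX; have [lD _ LD] := hD.
have De i x : D (Th e (X i) x) = 0.
  move: x; apply: (eq_of_homog hgA (f := fun x => D (Th e (X i) x)) (f' := fun=> 0)).
  - by move=> k x y; rewrite l3 lD.
  - by move=> k x y; rewrite scaler0 addr0.
  move=> s x hx; have := LD _ _ (Th e (X i) 1) (cur_homog hT he hf hx).
  rewrite (cur_br hT _ he hf he (hX i) hx) !ThE mulr1 (lin0 (l2 _ _)) scaler0 addr0.
  rewrite Def DeX (br0l hPT) (lin0 (lr _)) scaler0 addr0 (linZ lD) => /eqP.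
  by rewrite scaler_eq0 signr_eq0 => /eqP.
have Df i x : D (Th f (X i) x) = 0.
  have := der_even (Th e (X i) x) hD hf2.
  rewrite br_sl2 // !ThE (lin0 (l2 _ _)) addr0 De Dff (br0l hPT) (lin0 (lr _)) addr0.
  rewrite (linZ (l1 _ _)) (linZ lD) => /eqP.
  by rewrite scaler_eq0 (negPf (natK 1)) => /eqP.
have DX i j x : D (Th (X i) (X j) x) = 0.
  have EeX w : E e (X i) w = q (X i) w *: e - ((-1) ^+ p i * q e w) *: X i.
    exact: (EmapE hg hq w he (hX i)).
  have := LD _ _ (Th f (X j) x) (cur_homog hT he (hX i) hA1).
  rewrite (cur_br hT _ he (hX i) hf (hX j) hA1) !EeX (fr_ex fr) mul1r fr_fe.
  rewrite Xf DeX Df (br0l hPT) (lin0 (lr _)).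
  rewrite !(linB (l1 _ _), linB (l2 _ _), linZ (l1 _ _), linZ (l2 _ _)) Th_fe.
  rewrite !(linZ lD, linD lD, linN lD) Def Df De.
  rewrite !(scaler0, mulr0, scale0r, oppr0, addr0, add0r) mulrN1 scaleNr opprK.
  by move=> /eqP; rewrite !(scaler_eq0, signr_eq0) => /eqP.
move=> t; have [a [c [d [m [c' [a' ->]]]]]] := weight_decomposition t.
rewrite !(linD lD) Dee Def Dff /side /perp_part !(lin_sum lD) !big1 ?addr0 // => i _.
by rewrite (lin_sum lD) big1.
Qed.

Lemma der_minus_ad_h D : hder D ->
  exists s, homog gT b s /\ weight 0 (D h - br s h).
Proof.
move=> hD; have [lD dD _] := hD; have [s ws] := ad_h_cokernel (D h).
exists (- gT b s); split; first exact/(homogN hgT)/(gr_homog hgT).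
rewrite (br_even_skew _ hh) (linN (lr h)) opprK.
rewrite -(gT_br_even b s hh) -(_ : gT b (D h) = D h); last first.
  by have := dD _ _ hh; rewrite addbF.
rewrite -(linB (gr_lin hgT b)) /weight -(gT_br_even b _ hh).
by rewrite ws !scale0r (lin0 (gr_lin hgT b)).
Qed.

(** Applying [D] to [[h, e2] = 2 e2] shows that [D e2] is killed by [(2 - ad h)^2], hence has
    weight 2, and likewise for [f2].  Then [D [e2, f2]] shows that [D h] lies in [Th e f A]; it
    commutes with [e2], hence vanishes, which ties [D f2] to [D e2]. *)
Lemma der_weight0_sl2 D : hder D -> weight 0 (D h) ->
  exists x, [/\ homog gA b x, D h = 0, D e2 = Th e e x & D f2 = - Th f f x].
Proof.
move=> hD w0; have [lD dD _] := hD.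
have [c [m eDh]] := weight0_form w0.
have De x : br (D h) (Th e e x) = 2%:R *: Th e e (c * x).
  rewrite eDh (brDl hPT) br_perp_part ?fr_ex ?addr0 //; last exact: Xe.
  by rewrite br_odd_odd // !ThE; module K.
have Df x : br (D h) (Th f f x) = - 2%:R *: Th f f (c * x).
  rewrite eDh (brDl hPT) br_perp_part ?fr_fx ?addr0 //; last exact: Xf.
  by rewrite br_odd_odd // !ThE (linN (l1 _ _)) (linN (l2 _ _)); module K.
have wD2 : weight 2%:R (D e2).
  apply: weight2_coker; have := der_even e2 hD hh.
  rewrite (weight_ee 1) (linZ lD) De => ->; rewrite addrK.
  exact/weightZ/weight_ee.
have wDm2 : weight (- 2%:R) (D f2).
  apply: weightm2_coker; have := der_even f2 hD hh.
  rewrite (weight_ff 1) (linZ lD) Df !scaleNr => /(congr1 -%R).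
  rewrite opprD !opprK => ->; rewrite subrK.
  exact/weightZ/weight_ff.
have [x0 ex] := weight2_form wD2; have [y0 ey] := weightm2_form wDm2.
have hx : homog gA b (gA b x0) := gr_homog hgA b x0.
have {ex} ex : D e2 = Th e e (gA b x0).
  by have := dD _ _ he2; rewrite addbF /homog ex (gT_Th _ _ he he) addbF => ->.
move: (gA b x0) hx ex => {x0} x hx ex.
have ef : br e2 f2 = - 4%:R *: h.
  by rewrite br_sl2 // !ThE (linN (l1 _ _)) (linN (l2 _ _))
    (linZ (l1 _ _)) (linZ (l2 _ _)) Th_fe -/h; module K.
have : D (br e2 f2) = - 4%:R *: Th e f (x + y0).
  rewrite (der_even _ hD he2) ex ey br_odd_odd // br_sl2 // !ThE mulr1.
  by rewrite !(linN (l1 _ _), linN (l2 _ _), linZ (l1 _ _), linZ (l2 _ _), linD (l3 _ _)) !Th_fe; module K.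
rewrite ef (linZ lD) => /(scalerI _) => Dh.
have {}Dh : D h = Th e f (x + y0).
  by apply: Dh; rewrite oppr_eq0 natK.
have xy : x + y0 = 0.
  apply: Th_injee; have := der_even e2 hD hh.
  rewrite (weight_ee 1) (linZ lD) wD2 -[LHS]add0r => /addIr/esym.
  rewrite Dh br_odd_odd // !ThE mulr1 -mulr2n -scaler_nat => /eqP.
  by rewrite scaler_eq0 (negPf (natK 1)) => /eqP.
exists x; split=> //; first by rewrite Dh xy (lin0 (l3 _ _)).
by rewrite ey -(linN (l3 _ _)); congr (Th f f _); apply/eqP; rewrite -addr_eq0 addrC xy.
Qed.


Lemma der_minus_ad_sl2 D : hder D -> exists s, homog gT b s /\
  [/\ D h = br s h, D e2 = br s e2 & D f2 = br s f2].
Proof.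
move=> hD; have [s [hs ws]] := der_minus_ad_h hD.
have hD1 := homog_derivationB hPT hD (ad_homog_derivation hL hs).
have [x [hx e1 e3 e4]] := der_weight0_sl2 hD1 ws.
(* [Th e f y] acts on [e2] and [f2] as [2y] and [-2y]. *)
pose r := Th e f (2%:R^-1 *: x).
have hr : homog gT b r := cur_homog hT he hf (homogZ hgA _ hx).
have r2 u : 2%:R *: Th u u (2%:R^-1 *: x) = Th u u x.
  by rewrite (linZ (l3 _ _)) scalerA mulfV ?natK // scale1r.
have rh : br r h = 0.
  by rewrite (br_even_skew _ hh) weight_ef scale0r oppr0.
have re : br r e2 = Th e e x.
  by rewrite br_odd_odd // !ThE mulr1 -r2; module K.
have rf : br r f2 = - Th f f x.
  by rewrite br_odd_odd // !ThE mulr1 (linN (l1 _ _)) (linN (l2 _ _)) -r2; module K.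
exists (s + r); split; first exact: (homogD hgT).
rewrite !(brDl hPT) rh re rf -e3 -e4; split; last 2 first.
- by rewrite addrC subrK.
- by rewrite addrC subrK.
by apply/eqP; rewrite addr0 -subr_eq0 e1.
Qed.

(** [D] preserves weight 2, which defines [d] on [Th e e A]; commuting with [f2] transports it to
    [Th e f A] and [Th f f A]. *)
Lemma der_sl2A D : hder D -> D h = 0 -> D e2 = 0 -> D f2 = 0 ->
  exists d, homog_derivation gA *%R b d /\
    [/\ forall x, D (Th e e x) = Th e e (d x), forall x, D (Th e f x) = Th e f (d x)
      & forall x, D (Th f f x) = Th f f (d x)].
Proof.
move=> hD Dh De Df; have [lD dD LD] := hD.
have ex x : exists y, D (Th e e x) == Th e e y.
  suff /weight2_form[y ->] : weight 2%:R (D (Th e e x)) by exists y.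
  have := der_even (Th e e x) hD hh.
  by rewrite weight_ee (linZ lD) Dh (br0l hPT) add0r => /esym.
pose d x := xchoose (ex x); have dE x : D (Th e e x) = Th e e (d x).
  exact/eqP/(xchooseP (ex x)).
have inj x y : Th e e x = Th e e y -> x = y.
  move=> exy; apply/eqP; rewrite -subr_eq0; apply/eqP/Th_injee.
  by rewrite (linB (l3 _ _)) exy subrr.
have dEf x : D (Th e f x) = Th e f (d x).
  have := der_even (Th e e x) hD hf2; rewrite Df (br0l hPT) add0r dE !br_sl2 // !ThE.
  rewrite !(linZ (l1 _ _)) !(linZ (l2 _ _)) !Th_fe -!scalerDl (linZ lD).
  by apply: scalerI; rewrite -natrD natK.
have dff x : D (Th f f x) = Th f f (d x).
  have := der_even (Th e f x) hD hf2; rewrite Df (br0l hPT) add0r dEf !br_sl2 // !ThE.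
  rewrite !(linZ (l1 _ _)) !(lin0 (l2 _ _)) !addr0 (linZ lD).
  by apply: scalerI; rewrite natK.
exists d; split=> //; split=> [k x y|c x hx|c x y hx].
- by apply: inj; rewrite -dE !l3 lD !dE.
- apply: inj; have := dD _ _ (cur_homog hT he he hx).
  by rewrite dE /homog (gT_Th _ _ he he) /= addbF.
- apply: inj; apply: (@scalerI _ _ 2%:R); first exact: natK.
  have brE z w : br (Th e f z) (Th e e w) = 2%:R *: Th e e (z * w).
    by rewrite br_odd_odd // !ThE; module K.
  rewrite -dE -(linZ lD) -brE (LD _ _ _ (cur_homog hT he hf hx)) /=.
  by rewrite dEf dE !brE (linD (l3 _ _)) (linZ (l3 _ _)); module K.
Qed.

Lemma der_side D i : hder D -> D h = 0 -> exists a : I -> A,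
  (forall k, homog gA (b (+) p i (+) p k) (a k)) /\ D (Th e (X i) 1) = side e a.
Proof.
move=> hD Dh; have [lD dD _] := hD.
have [a ea] : exists a, D (Th e (X i) 1) = side e a.
  apply: weight1_form; have := der_even (Th e (X i) 1) hD hh.
  by rewrite weight_eX (linZ lD) Dh (br0l hPT) add0r => /esym.
exists (fun k => gA (b (+) p i (+) p k) (a k)); split=> [k|]; first exact: gr_homog.
have hi : homog gT (~~ p i) (Th e (X i) 1).
  by have := cur_homog hT he (hX i) hA1; rewrite addbF.
rewrite -(dD _ _ hi) ea /side (lin_sum (gr_lin hgT _)); apply: eq_bigr => k _.
rewrite (gT_Th _ _ he (hX k)); congr (Th e (X k) (gA _ _)).
by case: b (p i) (p k) => [] [] [].
Qed.

(** The skewness of [F], where [D (Th e v 1) = Th e F(v)], is the vanishing of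
    [D [Th e X_i 1, Th e X_j 1]].  The element [s] is [1/2 sum_i E(F X_i, Y_i)], with the sign that
    moving coefficients of [A] past vectors of [V] costs; as in [homog_skew_Emaps], each half of its
    bracket with [Th e X_j 1] is [D (Th e X_j 1)]. *)
Lemma der_frame_inner D : hder D -> D h = 0 -> (forall x, D (Th e e x) = 0) ->
  exists s, [/\ homog gT b s, forall u v x, homog g true u -> homog g true v ->
     (forall i, q (X i) u = 0) -> (forall i, q (X i) v = 0) ->
     (forall i, q (Y i) u = 0) -> (forall i, q (Y i) v = 0) ->
     br s (Th u v x) = 0 & forall i, br s (Th e (X i) 1) = D (Th e (X i) 1)].
Proof.
move=> hD Dh De; have [lD dD LD] := hD.
have /fin_all_exists[a ha] i := der_side i hD Dh.
have {ha} [ha Da] : (forall i k, homog gA (b (+) p i (+) p k) (a i k)) /\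
   forall i, D (Th e (X i) 1) = side e (a i).
  by split=> i; case: (ha i).
(* The sign of the bracket of [Th X_k Y_i a_ik] with [Th e X_i 1], so that it cancels there. *)
pose sg i k : K := (-1) ^+ ((b (+) p i (+) p k) && ~~ p i) * (-1) ^+ (p i (+) p k).
pose s := \sum_i \sum_k (2%:R^-1 * sg i k) *: Th (X k) (Y i) (a i k).
exists s; split.
- apply: (homog_sum hgT) => i _; apply: (homog_sum hgT) => k _; apply: (homogZ hgT).
  have := cur_homog hT (hX k) (hY i) (ha i k).
  by have -> : p k (+) p i (+) (b (+) p i (+) p k) = b by case: b (p i) (p k) => [] [] [].
- move=> u v x hu hv Xu Xv Yu Yv.
  rewrite (br_suml hPT) big1 // => i _; rewrite (br_suml hPT) big1 // => k _.
  rewrite (brZl hPT) (br_perp _ _ (hX k) (hY i) hu hv) ?scaler0 //.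
    exact: E_perp (hX k) (hY i) (Xu k) (Yu i).
  exact: E_perp (hX k) (hY i) (Xv k) (Yv i).
move=> j.
have EeX i w : E e (X i) w = q (X i) w *: e - ((-1) ^+ p i * q e w) *: X i.
  exact: (EmapE hg hq w he (hX i)).
have brEX c i k x y : homog gA c x -> br (Th e (X i) x) (Th e (X k) y)
    = ((-1) ^+ (c && ~~ p k) * (-1) ^+ (~~ p i) * q (X i) (X k)) *: Th e e (x * y).
  move=> hx; rewrite (cur_br hT _ he (hX i) he (hX k) hx) !EeX Xe (fr_ex fr) (odd_isotropic he).
  rewrite mulr0 !scale0r !subr0 (lin0 (l1 _ _)) add0r (linZ (l2 _ _)) !scalerA.
  by rewrite andbT !addTb.
(* Skewness of [F], extracted from the coefficient of [Th e e] in [D [Th e X_i 1, Th e X_j 1]]. *)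
have inv i : \sum_k q (X k) (X j) *: a i k =
    - ((-1) ^+ ((b (+) p i (+) p j) && ~~ p j) * (-1) ^+ p j
       * (-1) ^+ (b && ~~ p i) * (-1) ^+ p i) *: \sum_k q (X i) (X k) *: a j k.
  have hi : homog gT (~~ p i) (Th e (X i) 1).
    by have := cur_homog hT he (hX i) hA1; rewrite addbF.
  have := LD _ _ (Th e (X j) 1) hi; rewrite (brEX _ _ _ _ _ hA1) (linZ lD) De scaler0.
  rewrite !Da /side (br_suml hPT) (lin_sum (lr _)).
  under eq_bigr => k _ do rewrite (brEX _ _ _ _ _ (ha i k)) mulr1.
  under [X in _ *: X]eq_bigr => k _ do rewrite (brEX _ _ _ _ _ hA1) mul1r.
  have -> : \sum_k ((-1) ^+ ((b (+) p i (+) p k) && ~~ p j) * (-1) ^+ (~~ p k)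
       * q (X k) (X j)) *: Th e e (a i k) = 
     (- ((-1) ^+ ((b (+) p i (+) p j) && ~~ p j) * (-1) ^+ p j)) *:
       Th e e (\sum_k q (X k) (X j) *: a i k).
    rewrite (lin_sum (l3 _ _)) scaler_sumr; apply: eq_bigr => k _.
    rewrite (linZ (l3 _ _)) scalerA (q_degree hq (hX k) (hX j)).
    by congr (_ *: _); case: b (p i) (p j) (p k) => [] [] [] [] /=; ring.
  have -> : \sum_k ((-1) ^+ (false && ~~ p k) * (-1) ^+ (~~ p i) * q (X i) (X k)) *: Th e e (a j k)
     = - (-1) ^+ p i *: Th e e (\sum_k q (X i) (X k) *: a j k).
    rewrite (lin_sum (l3 _ _)) scaler_sumr; apply: eq_bigr => k _.
    by rewrite (linZ (l3 _ _)) scalerA; congr (_ *: _); case: (p i) => /=; ring.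
  set P := \sum_k _; set Q := \sum_k _ => e0; apply/eqP; rewrite -subr_eq0.
  apply/eqP/Th_injee; rewrite (linB (l3 _ _)) (linZ (l3 _ _)).
  move: (congr1 (fun t => (- ((-1) ^+ ((b (+) p i (+) p j) && ~~ p j) * (-1) ^+ p j)) *: t) e0).
  rewrite scaler0 => ->.
  by case: b (p i) (p j) => [] [] [] /=; module K.
have term i k : br (Th (X k) (Y i) (a i k)) (Th e (X j) 1) =
   ((-1) ^+ ((b (+) p i (+) p k) && ~~ p j) * (-1) ^+ (p k (+) p i)) *:
   (q (Y i) (X j) *: Th e (X k) (a i k)
     - ((-1) ^+ (p k && p i) * q (X k) (X j)) *: Th e (Y i) (a i k)).
  rewrite (cur_br hT _ (hX k) (hY i) he (hX j) (ha i k)) mulr1.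
  rewrite (E_perp (hX k) (hY i) (Xe k)) ?(q_perp he (hY i) (fr_ey fr i)) //.
  rewrite (lin0 (l1 _ _)) add0r andbT addTb /E (EmapE hg hq (X j) (hX k) (hY i)).
  by rewrite (linB (l2 _ _)) !(linZ (l2 _ _)) scalerA.
pose S1 i k := (sg i k * ((-1) ^+ ((b (+) p i (+) p k) && ~~ p j) * (-1) ^+ (p k (+) p i)))
  *: (q (Y i) (X j) *: Th e (X k) (a i k)).
pose S2 i k := (sg i k * ((-1) ^+ ((b (+) p i (+) p k) && ~~ p j) * (-1) ^+ (p k (+) p i)))
  *: (- ((-1) ^+ (p k && p i) * q (X k) (X j)) *: Th e (Y i) (a i k)).
have -> : br s (Th e (X j) 1) = 2%:R^-1 *: (\sum_i \sum_k S1 i k + \sum_i \sum_k S2 i k).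
  rewrite (br_suml hPT) -big_split scaler_sumr; apply: eq_bigr => i _ /=.
  rewrite (br_suml hPT) -big_split scaler_sumr; apply: eq_bigr => k _ /=.
  by rewrite (brZl hPT) term /S1 /S2; module K.
have -> : \sum_i \sum_k S1 i k = D (Th e (X j) 1).
  have Xj := fr_split fr (X j); rewrite (fr_fx fr) (fr_ex fr) !scale0r subr0 add0r in Xj.
  rewrite [X in D (Th e X 1)]Xj (lin_sum (l2 _ _)) (lin_sum lD); apply: eq_bigr => i _.
  rewrite (linZ (l2 _ _)) (linZ lD) Da scaler_sumr; apply: eq_bigr => k _.
  rewrite /S1 (q_degree hq (hY i) (hX j)) scalerA; congr (_ *: _); rewrite /sg.
  by case: b (p i) (p j) (p k) => [] [] [] [] /=; ring.
have -> : \sum_i \sum_k S2 i k = D (Th e (X j) 1).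
  transitivity (\sum_i (-1) ^+ p i *: Th e (Y i) (\sum_k q (X i) (X k) *: a j k)).
    apply: eq_bigr => i _.
    transitivity (- ((-1) ^+ ((b (+) p i (+) p j) && ~~ p i) * (-1) ^+ (p j && p i)
        * (-1) ^+ ((b (+) p i (+) p j) && ~~ p j)) *:
        Th e (Y i) (\sum_k q (X k) (X j) *: a i k)).
      rewrite (lin_sum (l3 _ _)) scaler_sumr; apply: eq_bigr => k _.
      rewrite (linZ (l3 _ _)) /S2 (q_degree hq (hX k) (hX j)) !scalerA.
      congr (_ *: _); rewrite /sg.
      by case: b (p i) (p j) (p k) => [] [] [] [] /=; ring.
    rewrite inv (linZ (l3 _ _)) scalerA; congr (_ *: _).
    by case: b (p i) (p j) => [] [] [] /=; ring.
  under eq_bigr => i _ do rewrite (lin_sum (l3 _ _)) scaler_sumr.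
  rewrite exchange_big Da; apply: eq_bigr => k _.
  rewrite [X in Th e X _](fr_dual fr k) (lin_sum (l2 _ _)); apply: eq_bigr => i _.
  rewrite (linZ (l3 _ _)) (linZ (l2 _ _)) scalerA; congr (_ *: _).
  by rewrite (q_sym_diag hq (hX k) (hX i)) (q_degree hq (hX i) (hX k)); case: (p i) (p k) => [] [] /=; ring.
by rewrite -mulr2n -scaler_nat scalerA mulVf ?natK // scale1r.
Qed.


(** [phi d] plays the role of [id (x) d]. *)
Theorem derivation_decomposition (phi : (A -> A) -> T -> T) D :
  (forall d, homog_derivation gA *%R b d -> hder (phi d) /\
     forall a c s u v x, homog g a u -> homog g c v -> homog gA s x ->
       phi d (Th u v x) = (-1) ^+ (b && (a (+) c)) *: Th u v (d x)) ->
  hder D ->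
  exists t d, homog_derivation gA *%R b d /\ D =1 (fun w => br t w + phi d w).
Proof.
move=> hphi hD; have [s [hs [Dh De Df]]] := der_minus_ad_sl2 hD.
have hD1 := homog_derivationB hPT hD (ad_homog_derivation hL hs).
have [|||d [hd [dee def dff]]] := der_sl2A hD1.
- by rewrite Dh subrr.
- by rewrite De subrr.
- by rewrite Df subrr.
have [hpd pd] := hphi d hd; have lpd : linear (phi d) by case: hpd.
have ld : linear d by case: hd.
have phi_odd u v x : homog g true u -> homog g true v -> phi d (Th u v x) = Th u v (d x).
  move=> hu hv; move: x.
  apply: (eq_of_homog hgA (f := fun x => phi d (Th u v x)) (f' := fun x => Th u v (d x))).
  - by move=> k x y; rewrite l3 lpd.
  - by move=> k x y; rewrite ld l3.
  by move=> c x hx; rewrite (pd _ _ _ _ _ _ hu hv hx) andbF scale1r.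
have hD2 := homog_derivationB hPT hD1 hpd.
have z2 x : D (Th e e x) - br s (Th e e x) - phi d (Th e e x) = 0.
  by rewrite dee phi_odd // subrr.
have z0 x : D (Th e f x) - br s (Th e f x) - phi d (Th e f x) = 0.
  by rewrite def phi_odd // subrr.
have zm x : D (Th f f x) - br s (Th f f x) - phi d (Th f f x) = 0.
  by rewrite dff phi_odd // subrr.
have [s' [hs' ks es]] := der_frame_inner hD2 (z0 1) z2.
have hD3 := homog_derivationB hPT hD2 (ad_homog_derivation hL hs').
have Ye i : q (Y i) e = 0 := q_perp he (hY i) (fr_ey fr i).
have Yf i : q (Y i) f = 0 := q_perp hf (hY i) (fr_fy fr i).
have z := derivation_eq0 hD3 _ _ _ _.
exists (s + s'), d; split=> // w; rewrite (brDl hPT).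
have : D w - br s w - phi d w - br s' w = 0.
  apply: z => [x|x|x|i].
  - by rewrite z2 ks ?subrr // => i; rewrite ?Xe ?Ye.
  - by rewrite z0 ks ?subrr // => i; rewrite ?Xe ?Ye ?Xf ?Yf.
  - by rewrite zm ks ?subrr // => i; rewrite ?Xf ?Yf.
  - by rewrite es subrr.
by move=> e0; apply/eqP; rewrite -subr_eq0 -e0; apply/eqP; module K.
Qed.

End Derivation.
End Model.

(** * Existence of a hyperbolic frame *)

Section ExistsFrame.
Variables (K : fieldType) (V : vectType K) (g : bool -> V -> V) (q : V -> V -> K).
Hypotheses (hg : is_grading g) (hq : quadratic_form g q).
Hypotheses (hnd : Defs.nondegenerate q) (charK : [pchar K] =i pred0).

(** Dual families of [V] are projected orthogonally off [<e,f>]; the projection [pr] is self-adjoint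
    and idempotent, so duality survives. *)
Lemma exists_hyperbolic_frame e : homog g true e -> e != 0 ->
  exists f (I : finType) (p : I -> bool) (x y : I -> V), hyperbolic_frame g q e f p x y.
Proof.
move=> he e0; have [I [p [x [y [hx hy xyE]]]]] := exists_frame hg hq hnd.
have [i yi] : exists i, q (y i) e != 0.
  apply/existsP; apply: contraNT e0; rewrite negb_exists => /forallP z.
  by rewrite (xyE e) big1 // => i _; have /negPn/eqP -> := z i; rewrite scale0r.
have pi : p i.
  by move: yi; rewrite (q_degree hq (hy i) he); case: (p i) => //; rewrite mul0r eqxx.
have [f [hf fe]] : exists f, homog g true f /\ q f e = 1.
  exists ((q (y i) e)^-1 *: y i); rewrite (qZl hq) mulVf //; split=> //.
  by apply: (homogZ hg); rewrite -pi.
have ef : q e f = -1 by rewrite (q_sym hq he hf) fe mulr1.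
have [ee ff] := (odd_isotropic hq charK he, odd_isotropic hq charK hf).
pose pr u := u - q f u *: e + q e u *: f.
have hpr a u : homog g a u -> homog g a (pr u).
  move=> hu; case: a hu => hu; first by do !apply: (homogD hg) => //;
    try apply: (homogN hg); apply: (homogZ hg).
  rewrite /pr (q_degree hq hf hu) (q_degree hq he hu) !mul0r !scale0r subr0 addr0.
  exact: hu.
have epr u : q e (pr u) = 0.
  by rewrite /pr (qDr hq) (qBr hq) !(qZr hq) ee ef; ring.
have fpr u : q f (pr u) = 0.
  by rewrite /pr (qDr hq) (qBr hq) !(qZr hq) ff fe; ring.
have perp a u v : homog g true u -> homog g a v -> q u v = 0 -> q v u = 0.
  by move=> hu hv e1; rewrite (q_sym hq hv hu) e1 mulr0.
have lpr : linear pr.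
  by move=> k u v; rewrite /pr !(qDr hq) !(qZr hq); module K.
have prr u v : q u e = 0 -> q u f = 0 -> q u (pr v) = q u v.
  by move=> ue uf; rewrite /pr (qDr hq) (qBr hq) !(qZr hq) ue uf; ring.
have prK u : pr (pr u) = pr u by rewrite {1}/pr epr fpr; module K.
exists f, I, p, (fun i => pr (x i)), (fun i => pr (y i)); split=> //.
- by move=> j; apply: hpr.
- by move=> j; apply: hpr.
- move=> u; rewrite -[LHS](_ : q f u *: e - q e u *: f + pr u = u); last first.
    by rewrite /pr; module K.
  congr (_ + _); rewrite -prK {1}[pr u]xyE (lin_sum lpr); apply: eq_bigr => j _.
  rewrite (linZ lpr); congr (_ *: _); rewrite /pr (qDr hq) (qBr hq) !(qZr hq).
  rewrite (qDl hq) (qBl hq) !(qZl hq).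
  rewrite (q_degree hq (hy j) he) (q_degree hq (hy j) hf).
  rewrite (q_sym hq (hy j) he) (q_sym hq (hy j) hf) (q_degree hq he (hy j)) (q_degree hq hf (hy j)).
  by case: (p j) => /=; ring.
- move=> k; have hk := hpr _ _ (hx k).
  have [ke kf] := (perp _ _ _ he hk (epr _), perp _ _ _ hf hk (fpr _)).
  rewrite -[LHS]prK {1}(dual_frame hq hnd xyE (pr (x k))) (lin_sum lpr).
  by apply: eq_bigr => j _; rewrite (linZ lpr) prr.
Qed.

End ExistsFrame.

(** * Derivations of osp and of its scalar extensions *)

Section Models.
Variables (K : fieldType) (V : vectType K) (g : bool -> V -> V) (q : V -> V -> K).
Hypotheses (hg : is_grading g) (hq : quadratic_form g q).
Hypotheses (hnd : Defs.nondegenerate q) (charK : [pchar K] =i pred0).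
Variable L : {vspace 'End(V)}.
Hypothesis hL : forall x, x \in L <-> osp g q x.
Let gL := sub_grading g (L := L).
Let brL := sub_bracket g (L := L).

Let K2 : 2%:R != 0 :> K. Proof. by move/pcharf0P: charK => ->. Qed.
Let lieL : lie_super gL brL := sub_lie_super hg hq hL.
Let El u v := @Eosp K V g q L u v.

Lemma Eosp_ind (P : subvs_of L -> Prop) : P 0 -> (forall s t, P s -> P t -> P (s + t)) ->
  (forall u v, P (El u v)) -> forall X, P X.
Proof.
move=> P0 PD PE X; have [I [p [x [y [hx hy xyE]]]]] := exists_frame hg hq hnd.
by rewrite (Eosp_span hg hq hnd K2 hL X hx hy xyE); apply: (big_ind P).
Qed.

Lemma Eosp_neq0 u p : Emap g q u u p != 0 -> El u u != 0.
Proof.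
apply: contraNneq => e; rewrite -(vsval_Eosp hg hq hL) -/(El u u) e.
by rewrite raddf0 lfunE.
Qed.

Lemma br_EospE a b c d u v w z :
  homog g a u -> homog g b v -> homog g c w -> homog g d z ->
  brL (El u v) (El w z) = El (Emap g q u v w) z
    + (-1) ^+ ((a (+) b) && c) *: El w (Emap g q u v z).
Proof.
move=> hu hv hw hz; have hE := Eosp_homog hg hq hL hu hv.
by rewrite /brL (br_Eosp hg hq hL hE hw hz) !(vsval_Eosp hg hq hL).
Qed.

Section Tensor.
Variables (A : algType K) (gA : bool -> A -> A).
Hypothesis hA : superextension gA.

Lemma tensor_current : osp_current g q gA (tens_grading gL gA)
  (tens_bracket gL brL gA) (fun u v x => tens (El u v) x).
Proof.
have hT := tens_lie_super lieL hA.
split=> //.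
- move=> v x; apply: (lin_comp (f := fun X => tens X x)); first exact: tens_linl.
  exact: (Eosp_linl hg hq hL).
- move=> u x; apply: (lin_comp (f := fun X => tens X x)); first exact: tens_linl.
  exact: (Eosp_linr hg hq hL).
- by move=> u v; apply: tens_linr.
- move=> a b c u v x hu hv hx.
  exact: (tens_homog lieL hA (Eosp_homog hg hq hL hu hv) hx).
- move=> a b u v x hu hv; rewrite /El (Eosp_sym hg hq hL hu hv).
  by rewrite (linN (tens_linl x)) (linZ (tens_linl x)).
- move=> a b c d s u v w z x y hu hv hw hz hx.
  have hE := Eosp_homog hg hq hL hw hz.
  rewrite (tens_bracketE lieL hA _ _ hx hE) (br_EospE hu hv hw hz).
  by rewrite (linD (tens_linl _)) (linZ (tens_linl _)).
- move=> P P0 PD PE t; rewrite (tens_decomp t).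
  apply: (big_ind P) => // i _; move: (tbasis i) (t i) => X x.
  apply: (@Eosp_ind (fun X => P (tens X x))) => //.
    by rewrite (lin0 (tens_linl x)).
  by move=> Y Z PY PZ; rewrite (linD (tens_linl x)); apply: PD.
- by move=> u p x /Eosp_neq0; apply: tens_inj.
Qed.

Lemma tensor_derivation e b D : homog g true e -> e != 0 ->
  homog_derivation (tens_grading gL gA) (tens_bracket gL brL gA) b D ->
  exists t d, homog_derivation gA *%R b d /\
    D =1 (fun w => tens_bracket gL brL gA t w + id_tens gL gA d w).
Proof.
move=> he e0 hD.
have [f [I [p [x [y fr]]]]] := exists_hyperbolic_frame hg hq hnd charK he e0.
apply: (derivation_decomposition hg hq hA charK tensor_current fr _ hD) => d hd.
split; first exact: homog_derivation_id_tens.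
move=> a c s u v z hu hv hz.
exact: (id_tensE lieL hA z hd (Eosp_homog hg hq hL hu hv)).
Qed.

End Tensor.

Let gK := @pure_grading K K^o false.

Lemma trivial_superextension : superextension (gK : bool -> (K^o : algType K) -> _).
Proof.
have hom (a : bool) (x : K^o) : homog gK a x -> a -> x = 0.
  by case: a => // <-.
split; [exact: pure_gradingP | by [] | |].
- move=> [] [] x y hx hy; rewrite /homog /gK /pure_grading //=.
    by rewrite (hom _ _ hx) // mul0r.
  by rewrite (hom _ _ hy) // mulr0.
- move=> a b x y hx hy; rewrite [x * y]mulrC.
  case: a b hx hy => [] [] hx hy; rewrite ?expr0 ?scale1r //.
  by rewrite (hom _ _ hx) // mulr0 scaler0.
Qed.

Lemma osp_self_current : osp_current g q (gK : bool -> (K^o : algType K) -> _) gL brL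
  (fun u v (x : K^o) => (x : K) *: El u v).
Proof.
have hPL := lie_product lieL.
split=> //.
- by move=> v x; apply: lin_scale; apply: (Eosp_linl hg hq hL).
- by move=> v x; apply: lin_scale; apply: (Eosp_linr hg hq hL).
- by move=> u v a x y; rewrite scalerDl scalerA.
- move=> a b c u v x hu hv hx; case: c hx => hx.
    by rewrite -hx scale0r; apply: (homog0 (prod_graded hPL)).
  by rewrite addbF; apply/(homogZ (prod_graded hPL))/(Eosp_homog hg hq hL).
- move=> a b u v x hu hv; rewrite /El (Eosp_sym hg hq hL hu hv).
  by rewrite scalerN !scalerA mulrC.
- move=> a b c d s u v w z x y hu hv hw hz hx.
  rewrite (brZl hPL) (linZ (prod_linr hPL _)) (br_EospE hu hv hw hz).
  case: s hx => hx; first by rewrite -hx mul0r !scale0r scaler0 addr0 scaler0.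
  by rewrite scale1r; module K.
- move=> P P0 PD PE; apply: Eosp_ind => // u v.
  by rewrite -[El u v]scale1r; apply: PE.
- move=> u p x /Eosp_neq0 nz /eqP; rewrite scaler_eq0 (negPf nz) orbF.
  by move/eqP.
Qed.

(** The decomposition for [A = K]: a derivation of [K] kills [1], hence is zero. *)
Lemma osp_derivation_inner e d : homog g true e -> e != 0 ->
  Der gL brL d <-> ad brL d.
Proof.
move=> he e0; have hPL := lie_product lieL; split; last first.
  by case=> x ex; apply: (Der_ext hPL (fun y => esym (ex y))); apply: Der_ad.
case/(DerE hPL)=> d0 [d1 [h0 h1 ed]].
have [f [I [p [x [y fr]]]]] := exists_hyperbolic_frame hg hq hnd charK he e0.
have core b D : homog_derivation gL brL b D -> exists t, D =1 brL t.
  move=> hD; have [] := derivation_decomposition hg hq trivial_superextension charK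
    osp_self_current fr (phi := fun _ _ => 0) _ hD.
    move=> d' hd'; split; first exact: homog_derivation0.
    move=> a c s u v z _ _ _; case: (hd') => ld' _ _.
    have -> : d' z = 0.
      have := linZ ld' z 1; rewrite (homog_derivation1 trivial_superextension hd') scaler0.
      by rewrite /GRing.scale /= mulr1.
    by rewrite scale0r scaler0.
  by move=> t [_ [_ eD]]; exists t => w; rewrite eD addr0.
have [t0 e0'] := core _ _ h0; have [t1 e1] := core _ _ h1.
by exists (t0 + t1) => w; rewrite ed e0' e1 (brDl hPL).
Qed.

End Models.

(** * The standard forms *)

Section OrthogonalSums.
Variable K : fieldType.

Lemma osp_datum_sum (U W : vectType K) gU gW (qU : U -> U -> K) (qW : W -> W -> K) r s r' s' :
  osp_datum gU qU r s -> osp_datum gW qW r' s' ->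
  osp_datum (V := (U * W)%type) (prod_grading gU gW) (orth_sum qU qW) (r + r') (s + s').
Proof.
move=> [hU rU sU qqU nU] [hW rW sW qqW nW].
have hUW := prod_gradingP hU hW.
have sdimD b : sdim (V := (U * W)%type) (prod_grading gU gW) b = (sdim gU b + sdim gW b)%N.
  pose iU (u : U) : U * W := (u, 0); pose iW (w : W) : U * W := (0, w).
  have lU : linear iU by move=> a u v; rewrite /iU; congr (_, _); rewrite /= scaler0 addr0.
  have lW : linear iW by move=> a u v; rewrite /iW; congr (_, _); rewrite /= scaler0 addr0.
  have kU (S : {vspace U}) : \dim (linfun iU @: S) = \dim S.
    apply: limg_dim_eq; apply/eqP; rewrite -subv0; apply/subvP => u.
    by rewrite memv_cap memv_ker (linfunE lU) => /andP[_ /eqP[->]]; rewrite mem0v.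
  have kW (S : {vspace W}) : \dim (linfun iW @: S) = \dim S.
    apply: limg_dim_eq; apply/eqP; rewrite -subv0; apply/subvP => u.
    by rewrite memv_cap memv_ker (linfunE lW) => /andP[_ /eqP[->]]; rewrite mem0v.
  rewrite /sdim -(kU (limg _)) -(kW (limg _)) -dimv_disjoint_sum; last first.
    apply/eqP; rewrite -subv0; apply/subvP => x; rewrite memv_cap memv0.
    case/andP=> /memv_imgP[u _ ->] /memv_imgP[w _].
    by rewrite (linfunE lU) (linfunE lW) => -[-> _]; apply/eqP; rewrite /iU.
  congr (\dim _); apply/vspaceP => x; apply/idP/idP.
    case/memv_imgP=> -[u w] _ ->; rewrite (linfunE (gr_lin hUW b)) /prod_grading /=.
    have -> : (gU b u, gW b w) = iU (gU b u) + iW (gW b w) :> U * W.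
      by rewrite /iU /iW; congr (_, _); rewrite /= ?addr0 ?add0r.
    rewrite -(linfunE lU) -(linfunE lW) -(linfunE (gr_lin hU b)) -(linfunE (gr_lin hW b)).
    by apply: memv_add; apply: memv_img; apply: memv_img; apply: memvf.
  case/memv_addP=> _ /memv_imgP[_ /memv_imgP[u _ ->] ->] [_ /memv_imgP[_ /memv_imgP[w _ ->] ->] ->].
  apply/memv_imgP; exists ((u, w) : U * W); first exact: memvf.
  rewrite (linfunE (gr_lin hUW b)) !(linfunE lU, linfunE lW) (linfunE (gr_lin hU b)).
  rewrite (linfunE (gr_lin hW b)) /iU /iW /prod_grading /=.
  by congr (_, _); rewrite /= ?addr0 ?add0r.
split; [exact: hUW | by rewrite sdimD rU rW | by rewrite sdimD sU sW | split |].
- move=> u a x y; rewrite /orth_sum /= (qDr qqU) (qDr qqW) (qZr qqU) (qZr qqW).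
  by ring.
- move=> u a x y; rewrite /orth_sum /= (qDl qqU) (qDl qqW) (qZl qqU) (qZl qqW).
  by ring.
- move=> a b [u w] [u' w'] [hu hw] [hu' hw'] ab; rewrite /orth_sum /=.
  by rewrite (q_degree qqU hu hu') (q_degree qqW hw hw') (negPf ab) !mul0r addr0.
- move=> a b [u w] [u' w'] [hu hw] [hu' hw']; rewrite /orth_sum /=.
  by rewrite (q_sym qqU hu hu') (q_sym qqW hw hw') mulrDr.
- move=> [u w] z; congr (_, _).
    by apply: nU => v; have := z (v, 0); rewrite /orth_sum /= (q0r qqW) addr0.
  by apply: nW => v; have := z (0, v); rewrite /orth_sum /= (q0r qqU) add0r.
Qed.

Lemma sdim_pure (U : vectType K) b0 b :
  sdim (@pure_grading K U b0) b = if b == b0 then dim U else 0%N.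
Proof.
have lp : linear (@pure_grading K U b0 b) := gr_lin (pure_gradingP U b0) b.
rewrite /sdim -dimvf; case: eqP => [bb|nb].
  have -> : limg (linfun (@pure_grading K U b0 b)) = fullv; last by [].
  apply/vspaceP => u; rewrite memvf; apply/memv_imgP; exists u; first exact: memvf.
  by rewrite (linfunE lp) /pure_grading bb eqxx.
have -> : limg (linfun (@pure_grading K U b0 b)) = 0%VS; last exact: dimv0.
apply/eqP; rewrite -subv0; apply/subvP => _ /memv_imgP[u _ ->].
by rewrite (linfunE lp) /pure_grading; case: eqP => // _; rewrite mem0v.
Qed.

Lemma osp_datum_pure (U : vectType K) (b : bool) (qU : U -> U -> K) :
  (forall u, scalar (qU u)) -> (forall u v, qU u v = (-1) ^+ b * qU v u) ->
  Defs.nondegenerate qU ->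
  osp_datum (@pure_grading K U b) qU (if b then 0%N else dim U) (if b then dim U else 0%N).
Proof.
move=> lq sq nU; split=> //; [exact: pure_gradingP | by rewrite sdim_pure; case: b {sq}..|].
have q0 u : qU u 0 = 0 by have := lq u (-1) 0 0; rewrite scaler0 addr0 mulN1r addNr.
have hom (a : bool) u : homog (@pure_grading K U b) a u -> a != b -> u = 0.
  by move=> hu ab; move: hu; rewrite /homog /pure_grading (negPf ab).
split=> // [v a x y|a a' u v hu hv aa'|a a' u v hu hv].
- by rewrite /= !(sq _ v) (lq v) mulrDr mulrCA.
- case: (a =P b) => [ab|/eqP ab]; last by rewrite (hom a u) // sq q0 mulr0.
  by rewrite (hom a' v) ?q0 // -ab eq_sym.
- case: (a =P b) => [ab|/eqP ab]; last by rewrite (hom a u) // q0 sq q0 !mulr0.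
  case: (a' =P b) => [ab'|/eqP ab']; last by rewrite (hom a' v) // q0 sq q0 !mulr0.
  by rewrite ab ab' andbb.
Qed.

Section Gram.
Variables (I : finType) (B : I -> I -> K).
Let W : vectType K := {ffun I -> K^o}.

Lemma gram_scalar u : scalar (form_of_gram B u : W -> K).
Proof.
move=> a v w; rewrite /form_of_gram mulr_sumr -big_split; apply: eq_bigr => i _ /=.
rewrite mulr_sumr -big_split; apply: eq_bigr => j _ /=.
by rewrite !ffunE /GRing.scale /=; ring.
Qed.

Lemma gram_sym k (u v : W) : (forall i j, B i j = k * B j i) ->
  form_of_gram B u v = k * form_of_gram B v u.
Proof.
move=> hB; rewrite /form_of_gram exchange_big mulr_sumr; apply: eq_bigr => i _.
rewrite mulr_sumr; apply: eq_bigr => j _; rewrite hB.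
by rewrite [u j * v i]mulrC mulrCA.
Qed.

(** A Gram matrix supported on the graph of an involution is monomial. *)
Lemma gram_nondegenerate (s : I -> I) : (forall i, s (s i) = i) ->
  (forall i j, (B i j != 0) = (i == s j)) -> Defs.nondegenerate (form_of_gram B : W -> W -> K).
Proof.
move=> sK hB u z; apply/ffunP => i; rewrite ffunE.
pose v : W := [ffun j => (j == s i)%:R].
have vE k : \sum_j u k * v j * B k j = u k * B k (s i).
  rewrite (bigD1 (s i)) //= big1 => [|j ji]; first by rewrite ffunE eqxx mulr1 addr0.
  by rewrite ffunE (negPf ji) mulr0 mul0r.
have := z v; rewrite /form_of_gram; under eq_bigr => k _ do rewrite vE.
rewrite (bigD1 i) //= big1 => [|k ki]; last first.
  have : B k (s i) == 0 by rewrite -[_ == 0]negbK hB sK.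
  by move/eqP ->; rewrite mulr0.
rewrite addr0 => /eqP; rewrite mulf_eq0.
have -> : (B i (s i) == 0) = false by apply/negbTE; rewrite hB sK.
by rewrite orbF => /eqP.
Qed.

End Gram.


Let flip m (i : 'I_m * bool) := (i.1, ~~ i.2).
Let flipK m (i : 'I_m * bool) : flip (flip i) = i.
Proof. by case: i => i b; rewrite /flip negbK. Qed.

Lemma hyp_dim m : dim (hyp_space K m) = (2 * m)%N.
Proof. by rewrite /dim /= card_prod card_ord card_bool muln1 mulnC. Qed.

Lemma hyp_datum m :
  osp_datum (@pure_grading K (hyp_space K m) false) (@hyp_form K m) (2 * m) 0.
Proof.
rewrite -hyp_dim; apply: (osp_datum_pure (b := false)).
- exact: gram_scalar.
- move=> u v; apply: gram_sym => i j; rewrite mul1r eq_sym.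
  by rewrite [i.2 == _]eq_sym.
- apply: (gram_nondegenerate (@flipK m)) => -[i a] [j b]; rewrite /flip /= xpair_eqE.
  by case: (i == j); case: a b => [] []; rewrite /= ?oner_eq0 ?eqxx.
Qed.

Lemma alt_datum n :
  osp_datum (@pure_grading K (hyp_space K n) true) (@alt_form K n) 0 (2 * n).
Proof.
rewrite -hyp_dim; apply: (osp_datum_pure (b := true)).
- exact: gram_scalar.
- move=> u v; apply: gram_sym => i j; rewrite eq_sym; case: eqP => _; ring.
- apply: (gram_nondegenerate (@flipK n)) => -[i a] [j b]; rewrite /flip /= xpair_eqE.
  by case: (i == j); case: a b => [] [];
    rewrite /= ?subrr ?subr0 ?sub0r ?oppr_eq0 ?oner_eq0 ?eqxx.
Qed.

Lemma unit_datum : osp_datum (@pure_grading K K^o false) (@unit_form K) 1 0.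
Proof.
apply: (osp_datum_pure (U := K^o) (b := false)).
- by move=> u a x y; rewrite /unit_form /GRing.scale /=; ring.
- by move=> u v; rewrite /unit_form mul1r mulrC.
- by move=> u z; have := z 1; rewrite /unit_form mulr1.
Qed.

End OrthogonalSums.

Lemma odd_vector (K : fieldType) (V : vectType K) (g : bool -> V -> V) q r s :
  osp_datum g q r s -> (0 < s)%N -> exists2 e, homog g true e & e != 0.
Proof.
move=> [hg _ ds _ _] s0; set S := limg (linfun (g true)).
have S0 : S != 0%VS by rewrite -dimv_eq0 -/(sdim g true) ds -lt0n.
exists (vpick S); last by rewrite vpick0.
have /memv_imgP[u _ ->] := memv_pick S.
by rewrite (linfunE (gr_lin hg true)); apply: gr_homog.
Qed.

Theorem corollary4p13 (K : closedFieldType) (charK0 : [pchar K] =i pred0) :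
  (forall m n : nat, (0 < m)%N -> (0 < n)%N ->
     let g : bool -> (hyp_space K m * hyp_space K n)%type -> _ :=
       prod_grading (pure_grading false) (pure_grading true) in
     let q := orth_sum (@hyp_form K m) (@alt_form K n) in
     let g' := prod_grading g (@pure_grading K K^o false) in
     let q' := orth_sum q (@unit_form K) in
     [/\ osp_datum g q (2 * m) (2 * n),
         forall x, eosp g q x <-> osp g q x,
         osp_datum g' q' (2 * m + 1) (2 * n)
       & forall x, eosp g' q' x <-> osp g' q' x])
  /\
  (forall (m n : nat), (0 < m)%N -> (0 < n)%N ->
     forall (V : vectType K) (g : bool -> V -> V) (q : V -> V -> K),
     osp_datum g q m (2 * n) ->
     forall L : {vspace 'End(V)}, (forall x, x \in L <-> osp g q x) ->
     let gL := sub_grading g (L := L) in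
     let brL := sub_bracket g (L := L) in
     (forall (A : algType K) (gA : bool -> A -> A), superextension gA ->
        let gT := tens_grading gL gA in
        let brT := tens_bracket gL brL gA in
        let DerA := Der gA *%R in
        lie_embedding gA gT DerA (id_tens gL gA) /\
        semidirect gT (Der gT brT) (ad brT) (image_of DerA (id_tens gL gA)))
     /\ (forall d, Der gL brL d <-> ad brL d)).
Proof.
have K2 : 2%:R != 0 :> K by move/pcharf0P: charK0 => ->.
split=> [m n _ _ g q g' q' | m n _ n0 V g q hd L hL gL brL].
  have hd : osp_datum g q (2 * m) (2 * n).
    have := osp_datum_sum (hyp_datum K m) (alt_datum K n); rewrite addn0 add0n; exact.
  have hd' : osp_datum g' q' (2 * m + 1) (2 * n).
    have := osp_datum_sum hd (unit_datum K); rewrite addn0; exact.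
  split=> // x.
    by case: hd => hg _ _ hq hnd; apply: eosp_eq_osp.
  by case: hd' => hg _ _ hq hnd; apply: eosp_eq_osp.
have [|e he e0] := odd_vector hd; first by rewrite muln_gt0.
case: hd => hg _ _ hq hnd; split=> [A gA hA gT brT DerA|d]; last first.
  exact: (osp_derivation_inner hg hq hnd charK0 hL d he e0).
have lieL := sub_lie_super hg hq hL.
have [f [I [p [x [y fr]]]]] := exists_hyperbolic_frame hg hq hnd charK0 he e0.
have Ee : Emap g q e e f != 0.
  rewrite (Eee_f hg hq fr) oppr_eq0 scaler_eq0 (negPf K2) /=; exact: e0.
split.
  apply: (id_tens_lie_embedding lieL hA _ (Eosp_neq0 hg hq hL Ee)).
  exact: (Eosp_homog hg hq hL he he).
apply: (tens_semidirect lieL hA) => b D hD.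
exact: (tensor_derivation hg hq hnd charK0 hL hA he e0 hD).
Qed.
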